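(* Let $n\ge1$ be an integer and let $-1\le B<A\le 1$ with $B\le 0$. Then the $\mathcal{SL}_n$-radius for the class $\mathcal{ST}_n[A,B]$ is $$R_{\mathcal{SL}_n}(\mathcal{ST}_n[A,B])=\min\left(1,\left(\frac{2(\sqrt2-1)}{(A-B)+\sqrt{(A-B)^2+4(\sqrt2B-A)B(\sqrt2-1)}}\right)^{1/n}\right).$$ In particular, if $1+A<\sqrt2(1+B)$, then $\mathcal{ST}_n[A,B]\subseteq\mathcal{SL}_n$. Also, the $\mathcal{SL}$-radius for the class $\mathcal{ST}$ of starlike functions is $3-2\sqrt2$.
   Context: $\mathbb{D}=\{z\in\mathbb{C}:|z|<1\}$, $\mathbb{D}_r=\{z\in\mathbb{C}:|z|<r\}$. For an integer $n\ge1$, $\mathcal{A}_n$ is the class of analytic functions on $\mathbb{D}$ of the form $f(z)=z+\sum_{k\ge n+1}a_kz^k$, and $\mathcal{A}=\mathcal{A}_1$. For analytic $f,g$ on $\mathbb{D}$, $f\prec g$ (subordination) means $f=g\circ w$ for some analytic $w$ on $\mathbb{D}$ with $w(0)=0$ and $|w(z)|<1$. For $-1\le B<A\le1$, $\mathcal{P}_n[A,B]$ is the class of analytic functions $p(z)=1+c_nz^n+c_{n+1}z^{n+1}+\cdots$ on $\mathbb{D}$ with $p(z)\prec(1+Az)/(1+Bz)$, and $\mathcal{ST}_n[A,B]:=\{f\in\mathcal{A}_n: zf'(z)/f(z)\in\mathcal{P}_n[A,B]\}$ (Janowski starlike functions). $\mathcal{ST}$ is the class of $f\in\mathcal{A}$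 with $zf'(z)/f(z)\prec(1+z)/(1-z)$. $\mathcal{SL}_n$ is the class of $f\in\mathcal{A}_n$ such that $\left|\left(zf'(z)/f(z)\right)^2-1\right|<1$ for all $z\in\mathbb{D}$ (with $zf'(z)/f(z)$ taken to be $1$ at $z=0$), and $\mathcal{SL}=\mathcal{SL}_1$. For a class $\mathcal{M}\subset\mathcal{A}_n$, the $\mathcal{SL}_n$-radius $R_{\mathcal{SL}_n}(\mathcal{M})$ is the largest number $R\in(0,1]$ such that for every $f\in\mathcal{M}$ and every $r<R$ one has $\left|\left(zf'(z)/f(z)\right)^2-1\right|<1$ for all $z\in\mathbb{D}_r$; the $\mathcal{SL}$-radius is the case $n=1$. *)

(* Defs.v *)
From Stdlib Require Import Reals.
From Coquelicot Require Import Coquelicot.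
Open Scope R_scope.

(* A function on the open unit disk is represented by a total function C -> C;
   every notion below only depends on its values on the disk. *)
Definition disk (r : R) (z : C) : Prop := Cmod z < r.

(* Analytic means complex differentiable at every point of the open disk. *)
Definition analytic_on_disk (f : C -> C) : Prop :=
  forall z : C, disk 1 z -> ex_derive (K := C_AbsRing) (V := C_NormedModule) f z.

Definition power_series_on_disk (a : nat -> C) (f : C -> C) : Prop :=
  forall z : C, disk 1 z ->
    is_pseries (K := C_AbsRing) (V := C_NormedModule) a z (f z).

(* f(z) = z + a_{n+1} z^{n+1} + a_{n+2} z^{n+2} + ... *)
Definition class_A (n : nat) (f : C -> C) : Prop :=
  analytic_on_disk f /\
  exists a : nat -> C,
    a 0%nat = 0 /\ a 1%nat = 1 /\
    (forall k : nat, (1 < k <= n)%nat -> a k = 0) /\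
    power_series_on_disk a f.

Definition subordinate (f g : C -> C) : Prop :=
  analytic_on_disk f /\ analytic_on_disk g /\
  exists w : C -> C,
    analytic_on_disk w /\ w 0 = 0 /\
    (forall z : C, disk 1 z -> Cmod (w z) < 1) /\
    (forall z : C, disk 1 z -> f z = g (w z)).

(* p(z) = 1 + c_n z^n + c_{n+1} z^{n+1} + ..., p subordinate to (1+Az)/(1+Bz) *)
Definition class_P (n : nat) (A B : R) (p : C -> C) : Prop :=
  analytic_on_disk p /\
  (exists c : nat -> C,
    c 0%nat = 1 /\
    (forall k : nat, (0 < k < n)%nat -> c k = 0) /\
    power_series_on_disk c p) /\
  subordinate p (fun z : C => ((1 + A * z) / (1 + B * z))%C).

(* z f'(z) / f(z), with the value 1 at the origin.  Division by zero gives 0,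
   which does no harm: at a zero z0 <> 0 of f the true quotient has a pole, so
   this function is not continuous at z0, hence not analytic, and its value 0
   at z0 also violates |q^2 - 1| < 1. *)
Definition log_deriv (f : C -> C) (z : C) : C :=
  if Ceq_dec z 0 then 1 else (z * C_derive f z / f z)%C.

Definition class_STn (n : nat) (A B : R) (f : C -> C) : Prop :=
  class_A n f /\ class_P n A B (log_deriv f).

Definition class_ST (f : C -> C) : Prop :=
  class_A 1 f /\
  subordinate (log_deriv f) (fun z : C => ((1 + z) / (1 - z))%C).

Definition lemniscate_on (r : R) (f : C -> C) : Prop :=
  forall z : C, disk r z -> Cmod ((log_deriv f z) ^ 2 - 1)%C < 1.

Definition class_SL (n : nat) (f : C -> C) : Prop :=
  class_A n f /\ lemniscate_on 1 f.

Definition SL_radius_bound (M : (C -> C) -> Prop) (rho : R) : Prop :=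
  0 < rho <= 1 /\
  forall f : C -> C, M f -> forall r : R, r < rho -> lemniscate_on r f.

(* "rho is the SL_n-radius of M", i.e. the largest admissible number.  For a
   class M contained in class_A n the defining condition does not involve n, so
   one predicate covers every n. *)
Definition is_SL_radius (M : (C -> C) -> Prop) (rho : R) : Prop :=
  SL_radius_bound M rho /\
  forall rho' : R, SL_radius_bound M rho' -> rho' <= rho.

(* Main.v *)
Require Import Defs.
From Stdlib Require Import Reals Lra Lia ClassicalEpsilon IndefiniteDescription.
From Coquelicot Require Import Coquelicot.
Open Scope R_scope.

(** The number under the square root is a perfect square,
    ((A - B) - 2 (sqrt 2 - 1) B)^2, so that the radius is the smaller of 1 and
    the n-th root of x = (sqrt 2 - 1) / (A - sqrt 2 B), the solution of
    (1 + A x) / (1 + B x) = sqrt 2.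

    Lower bound for the radius.  Write p = z f' / f = (1 + A w) / (1 + B w)
    with |w| < 1.  As B <= 0, |p - 1| <= (A - B) |w| / (1 + B |w|), which is
    less than sqrt 2 - 1 as soon as |w| < x; and |p - 1| < sqrt 2 - 1 gives
    |p^2 - 1| = |p - 1| |2 + (p - 1)| < (sqrt 2 - 1) (sqrt 2 + 1) = 1
    ([janowski_lemniscate]).  It remains to know that |w(z)| <= |z|^n.  If
    p = 1 + z^n g, then w = (p - 1) / (A - B p) = z^n g / (A - B p), and the
    maximum principle for g / (A - B p) gives the bound ([janowski_schwarz]).
    In the class of all starlike functions no expansion of p is given, but
    p = 1 + z phi' / phi where f = z phi: here phi has no zero, because the
    quotient z f' / f would be 0 there by convention, and (1 + w) / (1 - w) never
    vanishes ([ST_schwarz]).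

    The maximum principle is only needed for quotients of power series, and it
    is obtained without integration.  A power series on the disk can be divided
    by z - z0 after subtraction of its value at z0, and the quotient is again a
    power series ([power_series_factor]); hence these functions have second
    order expansions h0 + h1 t + h2 t^2 + o(t^2) at each point, a property which
    is stable under products and inverses ([jet]).  In the mean of |h|^2 over the
    four points z + d i^j the terms in t and t^2 cancel, so that
    |h|^2 + e |z|^2 has no interior local maximum for e > 0
    ([jet_no_local_max]).

    Sharpness.  Let f = z E(z^n), where E is the series of
    (1 + B u)^((A - B) / (n B)) (of exp (A u / n) when B = 0), the solution of
    (1 + B u) E' = ((A - B) / n) E with E(0) = 1.  It has no zero, since its
    product with the solution for the opposite exponent has derivative 0 and so
    is constantly 1.  Then z f' / f = (1 + A z^n) / (1 + B z^n), which for x < 1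
    takes the value sqrt 2 at the positive point where z^n = x, so that the
    inequality fails there ([extremal_log_deriv], [SL_radius_of_schwarz]). *)

(** * Germs with a Taylor expansion of finite order *)

(** Neighbourhoods measured by [Cmod]: the uniform structures of [C] as a normed
    module and as an absolute ring have different balls, and this form
    translates into both. *)
Definition near (z : C) (P : C -> Prop) : Prop :=
  exists d : R, 0 < d /\ forall t : C, Cmod (t - z) < d -> P t.

Lemma near_imp (z : C) (P Q : C -> Prop) :
  (forall t, P t -> Q t) -> near z P -> near z Q.
Proof. intros H [d [Hd HP]]; exists d; split; auto. Qed.

Lemma near_and (z : C) (P Q : C -> Prop) :
  near z P -> near z Q -> near z (fun t => P t /\ Q t).
Proof.
intros [d [Hd HP]] [e [He HQ]]; exists (Rmin d e); split.
- now apply Rmin_glb_lt.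
- intros t Ht; split; [apply HP | apply HQ]; eapply Rlt_le_trans; try exact Ht.
  + apply Rmin_l.
  + apply Rmin_r.
Qed.

Lemma Cmod_diag (z : C) : Cmod (z - z) = 0.
Proof. replace (z - z)%C with (RtoC 0) by ring. apply Cmod_0. Qed.

Lemma near_at (z : C) (P : C -> Prop) : near z P -> P z.
Proof. intros [d [Hd HP]]; apply HP; now rewrite Cmod_diag. Qed.

Lemma near_all (z : C) (P : C -> Prop) : (forall t, P t) -> near z P.
Proof. exists 1; split; [lra | auto]. Qed.

Lemma near_disk (r : R) (z : C) : disk r z -> near z (disk r).
Proof.
unfold disk; intros H; exists (r - Cmod z); split; [lra | intros t Ht].
replace t with (z + (t - z))%C by ring.
eapply Rle_lt_trans; [apply Cmod_triangle | lra].
Qed.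

Definition cont (f : C -> C) (z : C) : Prop :=
  forall e : R, 0 < e -> near z (fun t => Cmod (f t - f z) < e).

Lemma cont_ext (f g : C -> C) (z : C) :
  near z (fun t => f t = g t) -> cont f z -> cont g z.
Proof.
intros H Hf e He; specialize (Hf e He).
pose proof (near_at _ _ H) as E; simpl in E.
generalize (near_and _ _ _ H Hf); apply near_imp; intros t [H1 H2].
now rewrite <- H1, <- E.
Qed.

Lemma cont_const (c z : C) : cont (fun _ => c) z.
Proof. intros e He; apply near_all; intros _; now rewrite Cmod_diag. Qed.

Lemma cont_id (z : C) : cont (fun t => t) z.
Proof. intros e He; exists e; auto. Qed.

Lemma cont_plus (f g : C -> C) (z : C) :
  cont f z -> cont g z -> cont (fun t => f t + g t)%C z.
Proof.
intros Hf Hg e He.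
assert (He2 : 0 < e / 2) by lra.
generalize (near_and _ _ _ (Hf _ He2) (Hg _ He2)); apply near_imp.
intros t [H1 H2].
replace (f t + g t - (f z + g z))%C with ((f t - f z) + (g t - g z))%C by ring.
eapply Rle_lt_trans; [apply Cmod_triangle | lra].
Qed.

Lemma cont_mult (f g : C -> C) (z : C) :
  cont f z -> cont g z -> cont (fun t => f t * g t)%C z.
Proof.
intros Hf Hg e He.
set (m := 1 + Cmod (f z) + Cmod (g z)).
assert (Hm : 0 < m).
{ unfold m; pose proof (Cmod_ge_0 (f z)); pose proof (Cmod_ge_0 (g z)); lra. }
set (e' := Rmin 1 (e / m)).
assert (He' : 0 < e') by (apply Rmin_glb_lt; [lra | now apply Rdiv_lt_0_compat]).
assert (H1 : e' <= 1) by apply Rmin_l.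
assert (H2 : e' * m <= e).
{ apply Rle_trans with (e / m * m).
  - apply Rmult_le_compat_r; [lra | apply Rmin_r].
  - right; field; lra. }
generalize (near_and _ _ _ (Hf _ He') (Hg _ He')); apply near_imp.
intros t [Ht1 Ht2].
replace (f t * g t - f z * g z)%C
  with ((f t - f z) * (g t - g z) + (f z * (g t - g z) + (f t - f z) * g z))%C
  by ring.
eapply Rle_lt_trans; [apply Cmod_triangle |].
eapply Rle_lt_trans; [apply Rplus_le_compat_l, Cmod_triangle |].
rewrite !Cmod_mult.
assert (K : forall a b c d, 0 <= a -> 0 <= b -> 0 <= c -> 0 <= d ->
  e' * (1 + b + a) <= e -> d < e' -> c < e' -> d * c + (b * c + d * a) < e).
{ clear - He' H1; intros a b c d Ha Hb Hc Hd H2 H3 H4.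
  assert (d * c < e' * 1) by nra.
  assert (b * c <= b * e') by nra.
  assert (d * a <= e' * a) by nra.
  nra. }
apply K; auto using Cmod_ge_0.
Qed.

Lemma cont_near_neq0 (f : C -> C) (z : C) :
  cont f z -> f z <> 0 -> near z (fun t => Cmod (f z) / 2 < Cmod (f t)).
Proof.
intros Hf H0; apply Cmod_gt_0 in H0.
assert (H2 : 0 < Cmod (f z) / 2) by lra.
generalize (Hf _ H2); apply near_imp; intros t Ht.
assert (Cmod (f z) <= Cmod (f t) + Cmod (f t - f z)).
{ rewrite <- (Cmod_opp (f t - f z)).
  replace (f z) with (f t + - (f t - f z))%C at 1 by ring. apply Cmod_triangle. }
lra.
Qed.

Lemma cont_inv (f : C -> C) (z : C) :
  cont f z -> f z <> 0 -> cont (fun t => / f t)%C z.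
Proof.
intros Hf H0 e He.
pose proof (cont_near_neq0 f z Hf H0) as Hn.
pose proof (proj1 (Cmod_gt_0 _) H0) as Hp.
set (m := Cmod (f z)) in *.
assert (He' : 0 < e * (m * m / 2)) by (repeat apply Rmult_lt_0_compat; lra).
generalize (near_and _ _ _ Hn (Hf _ He')); apply near_imp; intros t [H1 H2].
assert (Ht : f t <> 0).
{ intros E; rewrite E, Cmod_0 in H1; lra. }
replace (/ f t - / f z)%C with (- (f t - f z) / (f t * f z))%C
  by (field; now split).
rewrite Cmod_div by now apply Cmult_neq_0.
rewrite Cmod_opp, Cmod_mult; fold m.
assert (Hd : m * m / 2 <= Cmod (f t) * m) by nra.
apply Rmult_lt_reg_r with (Cmod (f t) * m); [nra |].
unfold Rdiv; rewrite Rmult_assoc, Rinv_l by nra.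
nra.
Qed.

(** Taylor expansion of order [k] with continuous remainder factor, in
    Caratheodory's form: for [k = 2] it reads
    f t = a0 + (t - z) (a1 + (t - z) r(t)) with r continuous at [z].  In this
    form the stability under products and inverses is pure algebra. *)
Fixpoint jet (k : nat) (f : C -> C) (z : C) : Prop :=
  match k with
  | O => cont f z
  | S k => exists f1 : C -> C,
      near z (fun t => f t = f z + (t - z) * f1 t)%C /\ jet k f1 z
  end.

Lemma jet_ext (k : nat) (f g : C -> C) (z : C) :
  near z (fun t => f t = g t) -> jet k f z -> jet k g z.
Proof.
destruct k as [|k]; simpl; intros H; [now apply cont_ext |].
intros [f1 [H1 H2]]; exists f1; split; [| exact H2].
pose proof (near_at _ _ H) as E; simpl in E.
generalize (near_and _ _ _ H H1); apply near_imp; intros t [Ha Hb].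
now rewrite <- Ha, <- E.
Qed.

Lemma jet_cont (k : nat) (f : C -> C) (z : C) : jet k f z -> cont f z.
Proof.
revert f; induction k as [|k IH]; intros f; simpl; [auto |].
intros [f1 [H1 H2]]; apply IH in H2.
apply cont_ext with (f := fun t => (f z + (t + - z) * f1 t)%C).
- generalize H1; apply near_imp; intros t ->; reflexivity.
- apply cont_plus; [apply cont_const |].
  apply cont_mult; [| exact H2].
  apply cont_plus; [apply cont_id | apply cont_const].
Qed.

Lemma jet_pred (k : nat) (f : C -> C) (z : C) : jet (S k) f z -> jet k f z.
Proof.
revert f; induction k as [|k IH]; intros f; [exact (jet_cont 1 f z) |].
intros [f1 [H1 H2]]; exists f1; split; [exact H1 | exact (IH _ H2)].
Qed.

Lemma jet_const (k : nat) (c z : C) : jet k (fun _ => c) z.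
Proof.
revert c; induction k as [|k IH]; intros c; simpl; [apply cont_const |].
exists (fun _ => RtoC 0); split; [apply near_all; intros t; ring | apply IH].
Qed.

Lemma jet_id (k : nat) (z : C) : jet k (fun t => t) z.
Proof.
destruct k as [|k]; simpl; [apply cont_id |].
exists (fun _ => RtoC 1); split; [apply near_all; intros t; ring | apply jet_const].
Qed.

Lemma jet_plus (k : nat) (f g : C -> C) (z : C) :
  jet k f z -> jet k g z -> jet k (fun t => f t + g t)%C z.
Proof.
revert f g; induction k as [|k IH]; intros f g; simpl; [apply cont_plus |].
intros [f1 [H1 H2]] [g1 [H3 H4]]; exists (fun t => f1 t + g1 t)%C; split.
- generalize (near_and _ _ _ H1 H3); apply near_imp; intros t [-> ->]; ring.
- now apply IH.
Qed.

Lemma jet_mult (k : nat) (f g : C -> C) (z : C) :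
  jet k f z -> jet k g z -> jet k (fun t => f t * g t)%C z.
Proof.
revert f g; induction k as [|k IH]; intros f g Hf Hg; [now apply cont_mult |].
pose proof (jet_pred k g z Hg) as Hg'.
destruct Hf as [f1 [H1 H2]], Hg as [g1 [H3 H4]].
exists (fun t => f1 t * g t + f z * g1 t)%C; split.
- generalize (near_and _ _ _ H1 H3); apply near_imp; intros t [Ha Hb].
  rewrite Ha. replace ((t - z) * (f1 t * g t + f z * g1 t))%C
    with ((t - z) * f1 t * g t + f z * ((t - z) * g1 t))%C by ring.
  replace ((t - z) * g1 t)%C with (g t - g z)%C by (rewrite Hb; ring). ring.
- apply jet_plus; apply IH; try assumption; apply jet_const.
Qed.

(** From 1/f(t) - 1/f(z) = - (t - z) f1(t) / (f(z) f(t)): the order goes down by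
    one in [f1], so that 1/f on the right-hand side is covered by induction. *)
Lemma jet_inv (k : nat) (f : C -> C) (z : C) :
  jet k f z -> f z <> 0 -> jet k (fun t => / f t)%C z.
Proof.
revert f; induction k as [|k IH]; intros f Hf H0; [now apply cont_inv |].
pose proof (IH f (jet_pred k f z Hf) H0) as Hi.
pose proof (cont_near_neq0 f z (jet_cont _ _ _ Hf) H0) as Hn.
destruct Hf as [f1 [H1 H2]].
exists (fun t => (- / f z * f1 t) * / f t)%C; split.
- generalize (near_and _ _ _ H1 Hn); apply near_imp; intros t [Ha Hb].
  assert (Ht : f t <> 0).
  { intros E; rewrite E, Cmod_0 in Hb; pose proof (Cmod_ge_0 (f z)); lra. }
  replace ((t - z) * (- / f z * f1 t * / f t))%C
    with (- / f z * / f t * ((t - z) * f1 t))%C by ring.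
  replace ((t - z) * f1 t)%C with (f t - f z)%C by (rewrite Ha; ring).
  field; now split.
- apply jet_mult; [| exact Hi]. apply jet_mult; [apply jet_const | exact H2].
Qed.

Lemma jet_pow (k n : nat) (z : C) : jet k (fun t => t ^ n)%C z.
Proof.
induction n as [|n IH]; [exact (jet_const k 1 z) |].
apply jet_ext with (f := fun t => (t * t ^ n)%C).
- now apply near_all.
- apply jet_mult; [apply jet_id | exact IH].
Qed.

Lemma caratheodory (f f1 : C -> C) (z : C) :
  near z (fun t => f t = f z + (t - z) * f1 t)%C -> cont f1 z ->
  is_derive (K := C_AbsRing) (V := C_NormedModule) f z (f1 z).
Proof.
intros H Hc; split.
- apply is_linear_scal_l.
- intros x Hx.
  replace x with z by
    (apply (is_filter_lim_locally_unique (V := AbsRing_NormedModule C_AbsRing)); exact Hx).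
  intros e.
  destruct (near_and _ _ _ H (Hc e (cond_pos e))) as [d [Hd HP]].
  exists (mkposreal d Hd); intros t Ht.
  destruct (HP t Ht) as [H1 H2].
  change (Cmod ((f t - f z) - (t - z) * f1 z)%C <= e * Cmod (t - z)%C).
  rewrite H1.
  replace (f z + (t - z) * f1 t - f z - (t - z) * f1 z)%C
    with ((f1 t - f1 z) * (t - z))%C by ring.
  rewrite Cmod_mult. apply Rmult_le_compat_r; [apply Cmod_ge_0 | lra].
Qed.

Lemma jet_ex_derive (f : C -> C) (z : C) :
  jet 1 f z -> ex_derive (K := C_AbsRing) (V := C_NormedModule) f z.
Proof. intros [f1 [H1 H2]]; exists (f1 z); now apply caratheodory. Qed.

(** * The maximum principle and Schwarz's lemma *)

(** Compactness of the closed disk.  The gauge used on the square [-r, r]^2 is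
    small outside the disk, so that points of the disk are only attached to
    points of the disk; inside, it also encodes the local bound, as its
    inverse, and a positive lower bound for the gauge becomes a global bound. *)
Lemma disk_bounded (r : R) (g : C -> R) :
  (forall z, Cmod z <= r -> exists d B, 0 < d /\
     forall t, Cmod t <= r -> Cmod (t - z) < d -> g t <= B) ->
  exists B, forall t, Cmod t <= r -> g t <= B.
Proof.
intros Hloc.
assert (Hch : forall z : C, exists d : posreal,
  (Cmod z <= r ->
     forall t, Cmod t <= r -> Cmod (t - z) < 2 * d -> g t <= / d) /\
  (r < Cmod z -> 2 * d <= Cmod z - r)).
{ intros z. destruct (Rle_or_lt (Cmod z) r) as [Hz|Hz].
  - destruct (Hloc z Hz) as (d & B & Hd & HB).
    assert (HM : 0 < Rmax B 1) by (eapply Rlt_le_trans; [apply Rlt_0_1 | apply Rmax_r]).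
    assert (H0 : 0 < Rmin (d / 2) (/ Rmax B 1)).
    { apply Rmin_glb_lt; [lra | now apply Rinv_0_lt_compat]. }
    exists (mkposreal _ H0); split; [| lra]; simpl; intros _ t Ht1 Ht2.
    apply Rle_trans with (Rmax B 1).
    + apply Rle_trans with B; [| apply Rmax_l]. apply HB; [exact Ht1 |].
      pose proof (Rmin_l (d / 2) (/ Rmax B 1)); lra.
    + rewrite <- (Rinv_inv (Rmax B 1)) at 1.
      apply Rinv_le_contravar; [exact H0 | apply Rmin_r].
  - assert (H0 : 0 < (Cmod z - r) / 2) by lra.
    exists (mkposreal _ H0); split; simpl; lra. }
destruct (functional_choice _ Hch) as [delta Hdelta].
destruct (compactness_value_2d (- r) r (- r) r (fun u v => delta (u, v)))
  as [d Hd].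
exists (/ d); intros t Ht; apply Rnot_lt_le; intros Hlt.
destruct t as [x y].
assert (Hxy : Rabs x <= r /\ Rabs y <= r).
{ pose proof (Rmax_Cmod (x, y)) as H; simpl in H.
  split; eapply Rle_trans; try exact Ht; eapply Rle_trans; try exact H;
    [apply Rmax_l | apply Rmax_r]. }
destruct Hxy as [Hx Hy].
apply (Hd x y); [now apply Rabs_le_between | now apply Rabs_le_between |].
intros (u & v & _ & _ & H1 & H2 & H3).
assert (Hc : Cmod ((x, y) - (u, v)) < 2 * delta (u, v)).
{ replace ((x, y) - (u, v))%C with (RtoC (x - u) + RtoC (y - v) * Ci)%C.
  - eapply Rle_lt_trans; [apply Cmod_triangle |].
    rewrite Cmod_mult, Cmod_Ci, !Cmod_R; lra.
  - apply injective_projections; simpl; ring. }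
destruct (Hdelta (u, v)) as [Ha Hb].
destruct (Rle_or_lt (Cmod (u, v)) r) as [Hz|Hz].
- specialize (Ha Hz _ Ht Hc).
  assert (/ delta (u, v) <= / d) by (apply Rinv_le_contravar; [apply cond_pos | exact H3]).
  lra.
- specialize (Hb Hz).
  assert (Cmod (u, v) <= Cmod (x, y) + Cmod ((x, y) - (u, v))).
  { rewrite <- (Cmod_opp ((x, y) - (u, v))).
    replace (u, v) with ((x, y) + - ((x, y) - (u, v)))%C at 1 by ring.
    apply Cmod_triangle. }
  lra.
Qed.

(** If the supremum M were not attained, 1 / (M - u) would be locally bounded,
    hence bounded, which keeps [u] away from M. *)
Lemma disk_max (r : R) (u : C -> R) : 0 <= r ->
  (forall z, Cmod z <= r -> forall e, 0 < e -> near z (fun t => u t < u z + e)) ->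
  exists z, Cmod z <= r /\ forall t, Cmod t <= r -> u t <= u z.
Proof.
intros Hr Hu.
destruct (disk_bounded r u) as [B HB].
{ intros z Hz; destruct (Hu z Hz 1 Rlt_0_1) as [d [Hd H]].
  exists d, (u z + 1); split; [exact Hd |]; intros t _ Ht; left; now apply H. }
set (E := fun y => exists t, Cmod t <= r /\ y = u t).
destruct (completeness E) as [M [HM1 HM2]].
{ exists B; intros y [t [Ht ->]]; now apply HB. }
{ exists (u 0), (RtoC 0); rewrite Cmod_0; now split. }
assert (HM : forall t, Cmod t <= r -> u t <= M).
{ intros t Ht; apply HM1; now exists t. }
destruct (classic (exists z, Cmod z <= r /\ u z = M)) as [[z [Hz E1]]|Hno].
{ exists z; split; [exact Hz |]; rewrite E1; exact HM. }
exfalso.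
assert (Hlt : forall t, Cmod t <= r -> u t < M).
{ intros t Ht; destruct (Rle_lt_or_eq_dec _ _ (HM t Ht)) as [H|H]; [exact H |].
  exfalso; apply Hno; now exists t. }
destruct (disk_bounded r (fun t => / (M - u t))) as [K HK].
{ intros z Hz; pose proof (Hlt z Hz) as Hz'.
  assert (H2 : 0 < (M - u z) / 2) by lra.
  destruct (Hu z Hz _ H2) as [d [Hd H]].
  exists d, (/ ((M - u z) / 2)); split; [exact Hd |]; intros t _ Ht.
  specialize (H t Ht). apply Rinv_le_contravar; lra. }
assert (HK0 : 0 < K).
{ assert (H0 : Cmod 0 <= r) by now rewrite Cmod_0.
  specialize (HK 0 H0); pose proof (Hlt 0 H0).
  eapply Rlt_le_trans; [| exact HK]. apply Rinv_0_lt_compat; lra. }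
assert (HM3 : M <= M - / K).
{ apply HM2; intros y [t [Ht ->]].
  specialize (HK t Ht); pose proof (Hlt t Ht).
  assert (/ K <= M - u t).
  { rewrite <- (Rinv_inv (M - u t)). apply Rinv_le_contravar; [| exact HK].
    apply Rinv_0_lt_compat; lra. }
  lra. }
pose proof (Rinv_0_lt_compat _ HK0); lra.
Qed.

Lemma Cmod_sqr_plus_ge (a b : C) :
  Cmod a ^ 2 - 2 * (Cmod a * Cmod b) <= Cmod (a + b) ^ 2.
Proof.
assert (H : Rabs (Cmod a - Cmod b) <= Cmod (a + b)).
{ apply Rabs_le; split.
  - assert (Cmod b <= Cmod (a + b) + Cmod a); [| lra].
    rewrite <- (Cmod_opp a). replace b with ((a + b) + - a)%C at 1 by ring.
    apply Cmod_triangle.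
  - assert (Cmod a <= Cmod (a + b) + Cmod b); [| lra].
    rewrite <- (Cmod_opp b). replace a with ((a + b) + - b)%C at 1 by ring.
    apply Cmod_triangle. }
apply pow_maj_Rabs with (n := 2%nat) in H.
pose proof (pow2_ge_0 (Cmod b)). nra.
Qed.

(** The polynomial a + t b + t^2 c at t = d i^j, for j = 0, 2, 1, 3. *)
Lemma four_point_mean (a b c : C) (d : R) :
  Cmod (a + d * b + d ^ 2 * c) ^ 2 + Cmod (a - d * b + d ^ 2 * c) ^ 2 +
  Cmod (a + d * Ci * b - d ^ 2 * c) ^ 2 + Cmod (a - d * Ci * b - d ^ 2 * c) ^ 2 =
  4 * (Cmod a ^ 2 + d ^ 2 * Cmod b ^ 2 + d ^ 4 * Cmod c ^ 2).
Proof.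
rewrite !Cmod2_alt; destruct a as [a1 a2], b as [b1 b2], c as [c1 c2]; simpl; ring.
Qed.

(** By [four_point_mean], replacing [h] by its second order expansion, the mean
    of |h|^2 over the points z + d i^j is at least |h z|^2, with an error of
    2 L eta d^2, where eta bounds the variation of the remainder factor and
    L bounds the expansion.  The mean of e |t|^2 exceeds e |z|^2 by e d^2, which
    wins when 2 L eta < e. *)
Lemma jet_no_local_max (h : C -> C) (z : C) (e : R) :
  jet 2 h z -> 0 < e ->
  ~ near z (fun t => Cmod (h t) ^ 2 + e * Cmod t ^ 2 <=
                     Cmod (h z) ^ 2 + e * Cmod z ^ 2).
Proof.
intros [h1 [H1 [k [H2 Hk]]]] He Hmax; simpl in Hk.
set (L := Cmod (h z) + Cmod (h1 z) + Cmod (k z)).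
assert (HL : 0 <= L).
{ unfold L; pose proof (Cmod_ge_0 (h z)); pose proof (Cmod_ge_0 (h1 z));
  pose proof (Cmod_ge_0 (k z)); lra. }
set (eta := e / (2 * (L + 1))).
assert (Heta : 0 < eta) by (apply Rdiv_lt_0_compat; lra).
assert (HLe : 2 * (L * eta) < e).
{ assert (2 * ((L + 1) * eta) = e) by (unfold eta; field; lra). lra. }
destruct (near_and _ _ _ (near_and _ _ _ H1 H2) (near_and _ _ _ (Hk _ Heta) Hmax))
  as [d0 [Hd0 HP]].
set (d := Rmin 1 (d0 / 2)).
assert (Hd : 0 < d) by (apply Rmin_glb_lt; lra).
assert (Hd1 : d <= 1) by apply Rmin_l.
assert (Hd2 : d < d0) by (pose proof (Rmin_r 1 (d0 / 2)); fold d in H; lra).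
assert (Hpt : forall w : C, Cmod w = 1 ->
  Cmod (h z + d * w * h1 z + d ^ 2 * w ^ 2 * k z) ^ 2
    - 2 * (L * (d ^ 2 * eta)) + e * Cmod (z + d * w) ^ 2 <=
  Cmod (h z) ^ 2 + e * Cmod z ^ 2).
{ intros w Hw.
  assert (Hm : Cmod (z + d * w - z) < d0).
  { replace (z + d * w - z)%C with (d * w)%C by ring.
    rewrite Cmod_mult, Cmod_R, Hw, Rabs_pos_eq; lra. }
  destruct (HP _ Hm) as [[E1 E2] [E3 E4]].
  eapply Rle_trans; [| exact E4]. apply Rplus_le_compat_r.
  rewrite E1, E2.
  set (m := (h z + d * w * h1 z + d ^ 2 * w ^ 2 * k z)%C).
  set (x := (d ^ 2 * w ^ 2 * (k (z + d * w) - k z))%C).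
  replace (h z + (z + d * w - z) *
     (h1 z + (z + d * w - z) * k (z + d * w)))%C with (m + x)%C
    by (unfold m, x; ring).
  eapply Rle_trans; [| apply Cmod_sqr_plus_ge].
  assert (Hd2' : Cmod (d ^ 2 * w ^ 2)%C = d ^ 2).
  { rewrite Cmod_mult, !Cmod_pow, Hw, Cmod_R, Rabs_pos_eq by lra. ring. }
  assert (Hx : Cmod x <= d ^ 2 * eta).
  { unfold x; rewrite Cmod_mult, Hd2'. apply Rmult_le_compat_l; [apply pow2_ge_0 | lra]. }
  assert (HmL : Cmod m <= L).
  { unfold m, L.
    eapply Rle_trans; [apply Cmod_triangle |].
    eapply Rle_trans; [apply Rplus_le_compat_r, Cmod_triangle |].
    rewrite (Cmod_mult (d ^ 2 * w ^ 2)), Hd2', !Cmod_mult, Cmod_R, Hw, Rabs_pos_eq by lra.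
    pose proof (Cmod_ge_0 (h1 z)); pose proof (Cmod_ge_0 (k z)).
    assert (d ^ 2 <= 1) by nra. nra. }
  assert (Cmod m * Cmod x <= L * (d ^ 2 * eta))
    by (apply Rmult_le_compat; auto using Cmod_ge_0).
  lra. }
assert (HCi : Cmod (- Ci) = 1) by now rewrite Cmod_opp, Cmod_Ci.
pose proof (Hpt 1 Cmod_1) as P1. pose proof (Hpt (-(1))%C Cmod_m1) as P2.
pose proof (Hpt Ci Cmod_Ci) as P3. pose proof (Hpt (-Ci)%C HCi) as P4.
pose proof (four_point_mean (h z) (h1 z) (k z) d) as Q1.
pose proof (four_point_mean z 1 0 d) as Q2.
assert (HI : (Ci * Ci = -(1))%C).
{ apply injective_projections; simpl; ring. }
replace (h z + d * 1 * h1 z + d ^ 2 * 1 ^ 2 * k z)%C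
  with (h z + d * h1 z + d ^ 2 * k z)%C in P1 by ring.
replace (h z + d * - (1) * h1 z + d ^ 2 * (- (1)) ^ 2 * k z)%C
  with (h z - d * h1 z + d ^ 2 * k z)%C in P2 by ring.
replace (h z + d * Ci * h1 z + d ^ 2 * Ci ^ 2 * k z)%C
  with (h z + d * Ci * h1 z - d ^ 2 * k z)%C in P3
  by (replace (Ci ^ 2)%C with (-(1))%C by (rewrite <- HI; ring); ring).
replace (h z + d * - Ci * h1 z + d ^ 2 * (- Ci) ^ 2 * k z)%C
  with (h z - d * Ci * h1 z - d ^ 2 * k z)%C in P4
  by (replace ((-Ci) ^ 2)%C with (-(1))%C by (rewrite <- HI; ring); ring).
replace (z + d * 1 + d ^ 2 * 0)%C with (z + d * 1)%C in Q2 by ring.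
replace (z - d * 1 + d ^ 2 * 0)%C with (z + d * -(1))%C in Q2 by ring.
replace (z + d * Ci * 1 - d ^ 2 * 0)%C with (z + d * Ci)%C in Q2 by ring.
replace (z - d * Ci * 1 - d ^ 2 * 0)%C with (z + d * -Ci)%C in Q2 by ring.
rewrite Cmod_1, Cmod_0 in Q2.
assert (Hpos : 0 <= d ^ 2 * Cmod (h1 z) ^ 2 + d ^ 4 * Cmod (k z) ^ 2).
{ apply Rplus_le_le_0_compat; apply Rmult_le_pos; try apply pow2_ge_0; apply pow_le; lra. }
assert (Hfin : d ^ 2 * (2 * (L * eta)) < d ^ 2 * e)
  by (apply Rmult_lt_compat_l; [nra | exact HLe]).
nra.
Qed.

(** The term e |z|^2 forces the maximum of |h|^2 + e |z|^2 onto the boundary;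
    then e tends to 0. *)
Lemma max_principle (h : C -> C) (r B : R) :
  0 <= r -> 0 <= B -> (forall z, Cmod z <= r -> jet 2 h z) ->
  (forall z, Cmod z = r -> Cmod (h z) <= B) ->
  forall z, Cmod z <= r -> Cmod (h z) <= B.
Proof.
intros Hr HB Hj Hbd z Hz.
assert (Hsq : Cmod (h z) ^ 2 <= B ^ 2).
{ apply le_epsilon; intros e He.
  set (e' := e / (r ^ 2 + 1)).
  pose proof (pow2_ge_0 r) as Hr2.
  assert (He' : 0 < e') by (apply Rdiv_lt_0_compat; lra).
  assert (Ee : e' * r ^ 2 <= e).
  { assert (e' * (r ^ 2 + 1) = e) by (unfold e'; field; lra). lra. }
  destruct (disk_max r (fun t => Cmod (h t * h t) + e' * Cmod (t * t)) Hr)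
    as [z0 [Hz0 Hm]].
  { intros y Hy d Hd.
    assert (Hd2 : 0 < d / 2) by lra.
    assert (Hd3 : 0 < d / 2 / e') by now apply Rdiv_lt_0_compat.
    pose proof (jet_cont _ _ _ (Hj y Hy)) as Hc.
    assert (C1 : cont (fun t => h t * h t)%C y) by now apply cont_mult.
    assert (C2 : cont (fun t => t * t)%C y) by (apply cont_mult; apply cont_id).
    generalize (near_and _ _ _ (C1 _ Hd2) (C2 _ Hd3)); apply near_imp.
    intros t [T1 T2]; simpl in T1, T2.
    assert (U1 : Cmod (h t * h t) < Cmod (h y * h y) + d / 2).
    { replace (h t * h t)%C with ((h y * h y) + (h t * h t - h y * h y))%C by ring.
      eapply Rle_lt_trans; [apply Cmod_triangle | lra]. }
    assert (U2 : Cmod (t * t) < Cmod (y * y) + d / 2 / e').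
    { replace (t * t)%C with ((y * y) + (t * t - y * y))%C by ring.
      eapply Rle_lt_trans; [apply Cmod_triangle | lra]. }
    apply Rmult_lt_compat_l with (r := e') in U2; [| exact He'].
    replace (e' * (Cmod (y * y) + d / 2 / e')) with (e' * Cmod (y * y) + d / 2)
      in U2 by (field; lra).
    lra. }
  assert (Hm' : forall t, Cmod t <= r ->
    Cmod (h t) ^ 2 + e' * Cmod t ^ 2 <= Cmod (h z0) ^ 2 + e' * Cmod z0 ^ 2).
  { intros t Ht; specialize (Hm t Ht).
    rewrite !Cmod_mult in Hm. lra. }
  destruct (Rle_lt_or_eq_dec _ _ Hz0) as [Hin|Hon].
  - exfalso; apply (jet_no_local_max h z0 e' (Hj z0 Hz0) He').
    generalize (near_disk r z0 Hin); apply near_imp; intros t Ht.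
    apply Hm'; left; exact Ht.
  - specialize (Hm' z Hz). rewrite Hon in Hm'.
    assert (Cmod (h z0) ^ 2 <= B ^ 2)
      by (apply pow_incr; split; [apply Cmod_ge_0 | now apply Hbd]).
    assert (0 <= e' * Cmod z ^ 2) by (apply Rmult_le_pos; [lra | apply pow2_ge_0]).
    lra. }
apply Rsqr_incr_0_var; [| exact HB]. unfold Rsqr; lra.
Qed.

(** Schwarz's lemma for w = z^n h: on |z| = r the hypothesis gives
    |h| <= r^(-n), and r tends to 1. *)
Lemma schwarz_order (n : nat) (h : C -> C) :
  (forall z, disk 1 z -> jet 2 h z) ->
  (forall z, disk 1 z -> Cmod (z ^ n * h z) <= 1) ->
  forall z, disk 1 z -> Cmod (h z) <= 1.
Proof.
unfold disk; intros Hj Hb z Hz.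
assert (Hr : forall r, Cmod z < r < 1 -> r ^ n * Cmod (h z) <= 1).
{ intros r [Hr1 Hr2]. pose proof (Cmod_ge_0 z) as H0.
  assert (Hrn : 0 < r ^ n) by (apply pow_lt; lra).
  assert (H : Cmod (h z) <= / r ^ n).
  { apply (max_principle h r); try lra.
    - left; now apply Rinv_0_lt_compat.
    - intros t Ht; apply Hj; lra.
    - intros t Ht. assert (Ht1 : Cmod t < 1) by lra.
      specialize (Hb t Ht1). rewrite Cmod_mult, Cmod_pow, Ht in Hb.
      apply Rmult_le_reg_l with (r ^ n); [exact Hrn |].
      rewrite Rinv_r; lra. }
  apply Rmult_le_compat_l with (r := r ^ n) in H; [| lra].
  rewrite Rinv_r in H; lra. }
apply Rnot_lt_le; intros Hgt.
set (a := Cmod (h z)) in *.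
(* If a = |h z| > 1, Bernoulli's inequality makes r^n a > 1 for r near 1. *)
assert (Hbern : forall r, 0 <= r <= 1 -> 1 - INR n * (1 - r) <= r ^ n).
{ intros r Hr01; clear - Hr01; induction n as [|n IH]; [simpl; lra |].
  rewrite S_INR; simpl. pose proof (pos_INR n).
  apply Rle_trans with (r * (1 - INR n * (1 - r))).
  - assert (0 <= INR n * (1 - r) * (1 - r)) by (repeat apply Rmult_le_pos; lra). lra.
  - apply Rmult_le_compat_l; lra. }
pose proof (pos_INR n) as Hn. pose proof (Cmod_ge_0 z) as H0.
set (s := Rmin ((1 - Cmod z) / 2) ((a - 1) / (2 * a * (INR n + 1)))).
assert (Hs : 0 < s).
{ apply Rmin_glb_lt; [lra |]. apply Rdiv_lt_0_compat; [lra | nra]. }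
assert (Hs1 : s <= (1 - Cmod z) / 2) by apply Rmin_l.
assert (Hs2 : s * (2 * a * (INR n + 1)) <= a - 1).
{ assert (Hp : 0 < 2 * a * (INR n + 1)) by nra.
  apply Rle_trans with ((a - 1) / (2 * a * (INR n + 1)) * (2 * a * (INR n + 1))).
  - apply Rmult_le_compat_r; [lra | apply Rmin_r].
  - right; field; lra. }
assert (H1 : (1 - s) ^ n * a <= 1) by (apply Hr; lra).
assert (H2 : 1 - INR n * (1 - (1 - s)) <= (1 - s) ^ n) by (apply Hbern; lra).
assert (H3 : (1 - INR n * s) * a <= 1).
{ eapply Rle_trans; [| exact H1]. apply Rmult_le_compat_r; lra. }
nra.
Qed.

(** * Complex series and power series on the unit disk *)

Lemma Cmult_cancel_l (c a b : C) : (c * a = c * b)%C -> c <> 0 -> a = b.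
Proof.
intros H Hc. replace a with (/ c * (c * a))%C by (field; exact Hc).
rewrite H; field; exact Hc.
Qed.

Definition csum (u : nat -> C) (n : nat) : C := sum_n (G := C_AbelianMonoid) u n.

Definition Cseries (u : nat -> C) (l : C) : Prop :=
  is_series (K := C_AbsRing) (V := C_NormedModule) u l.

Lemma Cseries_eps (u : nat -> C) (l : C) :
  Cseries u l <->
  forall e, 0 < e -> exists N, forall n, (N <= n)%nat -> Cmod (csum u n - l) < e.
Proof.
split.
- intros H e He.
  assert (Hs : 0 < e / sqrt 2) by (apply Rdiv_lt_0_compat; [exact He | apply Rlt_sqrt2_0]).
  destruct (proj1 (filterlim_locally _ _) H (mkposreal _ Hs)) as [N HN].
  exists N; intros n Hn; specialize (HN n Hn).
  apply C_NormedModule_mixin_compat2 in HN; simpl in HN.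
  replace e with (sqrt 2 * (e / sqrt 2)); [exact HN |].
  field; pose proof Rlt_sqrt2_0; lra.
- intros H; apply filterlim_locally; intros e.
  destruct (H e (cond_pos e)) as [N HN]; exists N; intros n Hn.
  apply C_NormedModule_mixin_compat1; exact (HN n Hn).
Qed.

Lemma Cseries_ext (u v : nat -> C) (l : C) :
  (forall n, u n = v n) -> Cseries u l -> Cseries v l.
Proof. apply is_series_ext. Qed.

Lemma Cseries_plus (u v : nat -> C) (l m : C) :
  Cseries u l -> Cseries v m -> Cseries (fun n => u n + v n)%C (l + m)%C.
Proof. apply (is_series_plus (V := C_NormedModule)). Qed.

Lemma Cseries_scal (c : C) (u : nat -> C) (l : C) :
  Cseries u l -> Cseries (fun n => c * u n)%C (c * l)%C.
Proof. apply (is_series_scal (V := C_NormedModule)). Qed.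

Lemma Cseries_shift (u : nat -> C) (l : C) :
  Cseries u l <-> Cseries (fun n => u (S n)) (l - u 0%nat)%C.
Proof.
split; intros H.
- apply (is_series_incr_1 (V := C_NormedModule)).
  change (Cseries u (l - u 0%nat + u 0%nat)%C).
  now replace (l - u 0%nat + u 0%nat)%C with l by ring.
- apply (is_series_decr_1 (V := C_NormedModule)). exact H.
Qed.

Lemma Cseries_unique (u : nat -> C) (l m : C) : Cseries u l -> Cseries u m -> l = m.
Proof.
intros H1 H2. apply Ceq_minus, Cmod_eq_0.
apply Rle_antisym; [| apply Cmod_ge_0]. apply le_epsilon; intros e He.
assert (He2 : 0 < e / 2) by lra.
destruct (proj1 (Cseries_eps _ _) H1 _ He2) as [N1 K1].
destruct (proj1 (Cseries_eps _ _) H2 _ He2) as [N2 K2].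
specialize (K1 _ (Nat.le_max_l N1 N2)); specialize (K2 _ (Nat.le_max_r N1 N2)).
set (s := csum u (Nat.max N1 N2)) in *.
replace (l - m)%C with (- (s - l) + (s - m))%C by ring.
eapply Rle_trans; [apply Cmod_triangle |]. rewrite Cmod_opp; lra.
Qed.

Lemma csum_S (u : nat -> C) (n : nat) : csum u (S n) = (csum u n + u (S n))%C.
Proof. exact (sum_Sn (G := C_AbelianMonoid) u n). Qed.

Lemma csum_0 (u : nat -> C) : csum u 0 = u 0%nat.
Proof. exact (sum_O (G := C_AbelianMonoid) u). Qed.

Lemma Cseries_telescope (v : nat -> C) :
  (forall e, 0 < e -> exists N, forall n, (N <= n)%nat -> Cmod (v n) < e) ->
  Cseries (fun n => v n - v (S n))%C (v 0%nat).
Proof.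
intros Hv; apply Cseries_eps; intros e He.
assert (Hs : forall n, csum (fun n => v n - v (S n))%C n = (v 0%nat - v (S n))%C).
{ induction n as [|n IH]; [apply csum_0 |]. rewrite csum_S, IH; ring. }
destruct (Hv e He) as [N HN]; exists N; intros n Hn; rewrite Hs.
replace (v 0%nat - v (S n) - v 0%nat)%C with (- v (S n))%C by ring.
rewrite Cmod_opp; apply HN; lia.
Qed.

Lemma Cseries_term_bounded (u : nat -> C) (l : C) :
  Cseries u l -> exists M, forall k, Cmod (u k) <= M.
Proof.
intros H; destruct (proj1 (Cseries_eps _ _) H 1 Rlt_0_1) as [N HN].
assert (Hfin : forall m, exists M, forall k, (k <= m)%nat -> Cmod (u k) <= M).
{ induction m as [|m [M HM]].
  - exists (Cmod (u 0%nat)); intros k Hk; replace k with 0%nat by lia; lra.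
  - exists (Rmax M (Cmod (u (S m)))); intros k Hk.
    destruct (Nat.eq_dec k (S m)) as [->|Hne]; [apply Rmax_r |].
    eapply Rle_trans; [apply HM; lia | apply Rmax_l]. }
destruct (Hfin N) as [M HM]; exists (Rmax M 2); intros k.
destruct (Nat.le_gt_cases k N) as [Hk|Hk].
- eapply Rle_trans; [now apply HM | apply Rmax_l].
- destruct k as [|k]; [lia |].
  assert (K1 : Cmod (csum u k - l) < 1) by (apply HN; lia).
  assert (K2 : Cmod (csum u (S k) - l) < 1) by (apply HN; lia).
  rewrite csum_S in K2.
  apply Rle_trans with 2; [| apply Rmax_r].
  replace (u (S k)) with ((csum u k + u (S k) - l) + - (csum u k - l))%C by ring.
  eapply Rle_trans; [apply Cmod_triangle |]. rewrite Cmod_opp; lra.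
Qed.

Lemma Cseries_ex_geom (u : nat -> C) (M q : R) :
  0 <= q < 1 -> (forall k, Cmod (u k) <= M * q ^ k) -> exists l, Cseries u l.
Proof.
intros Hq Hu.
apply (ex_series_le (V := C_CompleteNormedModule) u (fun k => M * q ^ k)).
- intros k. exact (Hu k).
- apply (ex_series_scal (V := R_NormedModule) M (fun k => q ^ k)).
  apply ex_series_geom. rewrite Rabs_pos_eq; lra.
Qed.

Lemma Cseries_norm_geom (u : nat -> C) (l : C) (M q : R) :
  0 <= q < 1 -> (forall k, Cmod (u k) <= M * q ^ k) -> Cseries u l ->
  Cmod l <= M / (1 - q).
Proof.
intros Hq Hu H.
assert (HM : 0 <= M).
{ specialize (Hu 0%nat); pose proof (Cmod_ge_0 (u 0%nat)); simpl in Hu; lra. }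
assert (Hs : forall n, Cmod (csum u n) <= M / (1 - q) * (1 - q ^ S n)).
{ induction n as [|n IH].
  - rewrite csum_0. eapply Rle_trans; [apply Hu |]. simpl; right; field; lra.
  - rewrite csum_S. eapply Rle_trans; [apply Cmod_triangle |].
    eapply Rle_trans; [apply Rplus_le_compat; [apply IH | apply Hu] |].
    simpl; right; field; lra. }
apply le_epsilon; intros e He.
destruct (proj1 (Cseries_eps _ _) H e He) as [N HN].
specialize (HN N (Nat.le_refl N)); specialize (Hs N).
assert (M / (1 - q) * (1 - q ^ S N) <= M / (1 - q)).
{ rewrite <- (Rmult_1_r (M / (1 - q))) at 2. apply Rmult_le_compat_l.
  - apply Rdiv_le_0_compat; lra.
  - assert (0 <= q ^ S N) by (apply pow_le; lra). lra. }
replace l with (csum u N + - (csum u N - l))%C by ring.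
eapply Rle_trans; [apply Cmod_triangle |]. rewrite Cmod_opp; lra.
Qed.

Lemma pseries_Cseries (a : nat -> C) (z l : C) :
  is_pseries (K := C_AbsRing) (V := C_NormedModule) a z l <->
  Cseries (fun k => a k * z ^ k)%C l.
Proof.
assert (E : forall k, scal (K := C_AbsRing) (V := C_NormedModule) (pow_n z k) (a k)
                      = (a k * z ^ k)%C).
{ intros k; change (pow_n (K := C_AbsRing) z k * a k = a k * z ^ k)%C.
  replace (pow_n (K := C_AbsRing) z k) with (z ^ k)%C; [ring |].
  induction k as [|k IH]; simpl; [reflexivity |]. rewrite IH; reflexivity. }
split; apply is_series_ext; auto.
Qed.

(** Cauchy-Hadamard in the form that is used here: the power series of
    coefficients [a] converges on the unit disk if and only if this holds. *)
Definition geom_bounded (a : nat -> C) : Prop :=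
  forall r, 0 < r < 1 -> exists M, forall k, Cmod (a k) * r ^ k <= M.

Lemma power_series_geom_bounded (a : nat -> C) (f : C -> C) :
  power_series_on_disk a f -> geom_bounded a.
Proof.
intros H r Hr.
assert (Hd : disk 1 r) by (unfold disk; rewrite Cmod_R, Rabs_pos_eq; lra).
specialize (H r Hd); apply (proj1 (pseries_Cseries _ _ _)), Cseries_term_bounded in H.
destruct H as [M HM]; exists M; intros k; specialize (HM k).
rewrite Cmod_mult, Cmod_pow, Cmod_R, Rabs_pos_eq in HM by lra; exact HM.
Qed.

Lemma geom_bounded_terms (a : nat -> C) (r : R) :
  geom_bounded a -> 0 <= r < 1 -> exists M q, 0 <= q < 1 /\
  forall z, Cmod z <= r -> forall k, Cmod (a k * z ^ k) <= M * q ^ k.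
Proof.
intros Ha Hr. set (s := (1 + r) / 2).
assert (Hs : 0 < s < 1) by (unfold s; lra).
destruct (Ha s Hs) as [M HM]; exists M, (r / s); split.
{ split; [apply Rdiv_le_0_compat; lra |].
  apply Rmult_lt_reg_r with s; [lra |]. unfold Rdiv; rewrite Rmult_assoc, Rinv_l by lra.
  unfold s; lra. }
intros z Hz k; rewrite Cmod_mult, Cmod_pow.
apply Rle_trans with (Cmod (a k) * r ^ k).
- apply Rmult_le_compat_l; [apply Cmod_ge_0 |].
  apply pow_incr; split; [apply Cmod_ge_0 | exact Hz].
- unfold Rdiv; rewrite Rpow_mult_distr, pow_inv.
  pose proof (pow_lt s k (proj1 Hs)) as Hsk.
  replace (Cmod (a k) * r ^ k) with (Cmod (a k) * s ^ k * (r ^ k * / s ^ k))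
    by (field; lra).
  apply Rmult_le_compat_r; [| apply HM].
  apply Rmult_le_pos; [apply pow_le; lra | left; now apply Rinv_0_lt_compat].
Qed.

Definition psum (a : nat -> C) (z : C) : C :=
  epsilon (inhabits (RtoC 0)) (fun l => Cseries (fun k => a k * z ^ k)%C l).

Lemma psum_spec (a : nat -> C) (z : C) :
  geom_bounded a -> disk 1 z -> Cseries (fun k => a k * z ^ k)%C (psum a z).
Proof.
intros Ha Hz; unfold psum; apply epsilon_spec.
destruct (geom_bounded_terms a (Cmod z) Ha) as (M & q & Hq & H).
{ split; [apply Cmod_ge_0 | exact Hz]. }
apply (Cseries_ex_geom _ M q Hq). apply H; lra.
Qed.

Lemma power_series_psum (a : nat -> C) :
  geom_bounded a -> power_series_on_disk a (psum a).
Proof. intros Ha z Hz; apply pseries_Cseries; now apply psum_spec. Qed.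

Lemma power_series_bounded (a : nat -> C) (f : C -> C) (r : R) :
  power_series_on_disk a f -> 0 <= r < 1 ->
  exists M, forall z, Cmod z <= r -> Cmod (f z) <= M.
Proof.
intros H Hr.
destruct (geom_bounded_terms a r (power_series_geom_bounded _ _ H) Hr)
  as (M & q & Hq & HM).
exists (M / (1 - q)); intros z Hz; apply (Cseries_norm_geom _ (f z) M q Hq (HM z Hz)).
apply (proj1 (pseries_Cseries _ _ _)), H; unfold disk; lra.
Qed.

Lemma nat_geom_bounded (q : R) (k : nat) : 0 <= q < 1 -> INR k * q ^ k <= / (1 - q).
Proof.
intros Hq.
assert (H : INR k * q ^ k * (1 - q) <= 1 - q ^ k).
{ induction k as [|k IH]; [simpl; lra |].
  rewrite S_INR; simpl. assert (0 <= q ^ k) by (apply pow_le; lra).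
  assert (q * (INR k * q ^ k * (1 - q)) <= q * (1 - q ^ k))
    by (apply Rmult_le_compat_l; lra).
  assert (q * q ^ k * (1 - q) <= 1 * (1 - q)).
  { apply Rmult_le_compat_r; [lra |].
    change (q ^ S k <= 1). rewrite <- (pow1 (S k)). apply pow_incr; lra. }
  nra. }
apply Rmult_le_reg_r with (1 - q); [lra |]. rewrite Rinv_l by lra.
assert (0 <= q ^ k) by (apply pow_le; lra). lra.
Qed.

Lemma geom_bounded_shift (a : nat -> C) (m : nat) :
  geom_bounded a -> geom_bounded (fun k => a (m + k)%nat).
Proof.
intros Ha r Hr; destruct (Ha r Hr) as [M HM].
exists (M * / r ^ m); intros k; specialize (HM (m + k)%nat).
rewrite pow_add in HM.
assert (0 < r ^ m) by (apply pow_lt; lra).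
apply Rmult_le_reg_r with (r ^ m); [assumption |].
rewrite Rmult_assoc, Rmult_assoc, Rinv_l by lra. lra.
Qed.

Lemma geom_bounded_nat (a : nat -> C) :
  geom_bounded a -> geom_bounded (fun k => INR k * a k)%C.
Proof.
intros Ha r Hr. set (s := (1 + r) / 2).
assert (Hs : 0 < s < 1) by (unfold s; lra).
destruct (Ha s Hs) as [M HM].
assert (Hq : 0 <= r / s < 1).
{ split; [apply Rdiv_le_0_compat; lra |].
  apply Rmult_lt_reg_r with s; [lra |]. unfold Rdiv; rewrite Rmult_assoc, Rinv_l by lra.
  unfold s; lra. }
exists (M * / (1 - r / s)); intros k.
rewrite Cmod_mult, Cmod_R, Rabs_pos_eq by apply pos_INR.
pose proof (nat_geom_bounded (r / s) k Hq) as H.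
pose proof (pow_lt s k (proj1 Hs)) as Hsk.
replace (INR k * Cmod (a k) * r ^ k)
  with ((Cmod (a k) * s ^ k) * (INR k * (r / s) ^ k)).
- apply Rmult_le_compat; try assumption.
  + apply Rmult_le_pos; [apply Cmod_ge_0 | lra].
  + apply Rmult_le_pos; [apply pos_INR | apply pow_le; lra].
  + apply HM.
- unfold Rdiv; rewrite Rpow_mult_distr, pow_inv; field; lra.
Qed.

Lemma geom_bounded_terms_lim (a : nat -> C) (z : C) :
  geom_bounded a -> disk 1 z ->
  forall e, 0 < e -> exists N, forall k, (N <= k)%nat -> Cmod (a k * z ^ k) < e.
Proof.
intros Ha Hz e He.
pose proof (psum_spec a z Ha Hz) as H.
assert (He2 : 0 < e / 2) by lra.
destruct (proj1 (Cseries_eps _ _) H _ He2) as [N HN].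
exists (S N); intros k Hk; destruct k as [|k]; [lia |].
assert (K1 := HN k ltac:(lia)). assert (K2 := HN (S k) ltac:(lia)).
rewrite csum_S in K2.
set (s := csum (fun k => a k * z ^ k)%C k) in *. set (t := (a (S k) * z ^ S k)%C) in *.
replace t with ((s + t - psum a z) + - (s - psum a z))%C by ring.
eapply Rle_lt_trans; [apply Cmod_triangle |]. rewrite Cmod_opp; lra.
Qed.

(** The coefficients of (F z - F z0) / (z - z0), where F is the sum of the series
    of coefficients [a]: expand (z^k - z0^k) / (z - z0) and collect the powers
    of z. *)
Definition quot_coef (a : nat -> C) (z0 : C) (j : nat) : C :=
  psum (fun i => a (S j + i)%nat) z0.

Lemma quot_coef_rec (a : nat -> C) (z0 : C) (j : nat) :
  geom_bounded a -> disk 1 z0 ->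
  quot_coef a z0 j = (a (S j) + z0 * quot_coef a z0 (S j))%C.
Proof.
intros Ha Hz; unfold quot_coef.
pose proof (psum_spec _ z0 (geom_bounded_shift a (S j) Ha) Hz) as H1.
pose proof (psum_spec _ z0 (geom_bounded_shift a (S (S j)) Ha) Hz) as H2.
apply (proj1 (Cseries_shift _ _)) in H1. apply (Cseries_scal z0) in H2.
assert (H3 : Cseries (fun i => z0 * (a (S (S j) + i)%nat * z0 ^ i))%C
  (psum (fun i => a (S j + i)%nat) z0 - a (S j + 0)%nat * z0 ^ 0)%C).
{ revert H1; apply Cseries_ext; intros i.
  replace (S j + S i)%nat with (S (S j) + i)%nat by lia. simpl; ring. }
pose proof (Cseries_unique _ _ _ H2 H3) as E. rewrite E.
rewrite Nat.add_0_r; simpl; ring.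
Qed.

Lemma quot_coef_bounded (a : nat -> C) (z0 : C) :
  geom_bounded a -> disk 1 z0 -> geom_bounded (quot_coef a z0).
Proof.
unfold disk; intros Ha Hz r Hr.
set (s := Rmax r ((1 + Cmod z0) / 2)).
pose proof (Cmod_ge_0 z0) as H0.
assert (Hs : 0 < s < 1) by (unfold s; split;
  [eapply Rlt_le_trans; [apply Hr | apply Rmax_l] | apply Rmax_lub_lt; lra]).
assert (Hsz : Cmod z0 < s) by (eapply Rlt_le_trans; [| apply Rmax_r]; lra).
assert (Hsr : r <= s) by apply Rmax_l.
destruct (Ha s Hs) as [M HM].
assert (Hq : 0 <= Cmod z0 / s < 1).
{ split; [apply Rdiv_le_0_compat; lra |].
  apply Rmult_lt_reg_r with s; [lra |]. unfold Rdiv; rewrite Rmult_assoc, Rinv_l by lra.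
  lra. }
exists (M / s / (1 - Cmod z0 / s)); intros j.
pose proof (pow_lt s j (proj1 Hs)) as Hsj.
apply Rle_trans with (Cmod (quot_coef a z0 j) * s ^ j).
{ apply Rmult_le_compat_l; [apply Cmod_ge_0 | apply pow_incr; lra]. }
assert (H : Cmod (quot_coef a z0 j) <= M / s ^ S j / (1 - Cmod z0 / s)).
{ apply (Cseries_norm_geom (fun i => a (S j + i)%nat * z0 ^ i)%C); [exact Hq | |].
  - intros i; rewrite Cmod_mult, Cmod_pow; unfold Rdiv.
    rewrite Rpow_mult_distr, pow_inv.
    specialize (HM (S j + i)%nat); rewrite pow_add in HM.
    pose proof (pow_lt s i (proj1 Hs)); pose proof (pow_lt s (S j) (proj1 Hs)).
    replace (Cmod (a (S j + i)%nat) * Cmod z0 ^ i) with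
      (Cmod (a (S j + i)%nat) * (s ^ S j * s ^ i) * (/ s ^ S j * (Cmod z0 ^ i * / s ^ i)))
      by (field; lra).
    rewrite (Rmult_assoc M).
    apply Rmult_le_compat_r; [| exact HM].
    repeat apply Rmult_le_pos; try (left; apply Rinv_0_lt_compat; lra).
    apply pow_le; lra.
  - apply psum_spec; [now apply geom_bounded_shift | exact Hz]. }
apply Rmult_le_compat_r with (r := s ^ j) in H; [| lra].
eapply Rle_trans; [exact H |]. right; simpl; field; repeat split; try lra.
Qed.

(** Both conclusions rest on the recursion [quot_coef_rec].  The last one
    identifies the derivative [f1 z0] with the sum of the differentiated series:
    the terms b_k z0^k are the tails of the series of terms
    a_(k+1) z0^k, so this is a summation by parts. *)
Lemma power_series_factor (a : nat -> C) (f : C -> C) (z0 : C) :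
  power_series_on_disk a f -> disk 1 z0 ->
  exists b f1, power_series_on_disk b f1 /\
    (forall z, disk 1 z -> f z = f z0 + (z - z0) * f1 z)%C /\
    Cseries (fun k => INR (S k) * a (S k) * z0 ^ k)%C (f1 z0).
Proof.
intros Hf Hz0.
pose proof (power_series_geom_bounded _ _ Hf) as Ha.
pose proof (quot_coef_bounded a z0 Ha Hz0) as Hb.
set (b := quot_coef a z0) in *.
exists b, (psum b); split; [now apply power_series_psum |]; split.
- intros z Hz.
  pose proof (psum_spec b z Hb Hz) as H.
  pose proof (proj1 (pseries_Cseries _ _ _) (Hf z Hz)) as Hfz.
  assert (E0 : f z0 = (a 0%nat + z0 * b 0%nat)%C).
  { pose proof (proj1 (pseries_Cseries _ _ _) (Hf z0 Hz0)) as Hfz0.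
    apply (proj1 (Cseries_shift _ _)) in Hfz0.
    pose proof (psum_spec _ z0 (geom_bounded_shift a 1 Ha) Hz0) as H1.
    apply (Cseries_scal z0) in H1.
    assert (H2 : Cseries (fun i => z0 * (a (1 + i)%nat * z0 ^ i))%C
      (f z0 - a 0%nat * z0 ^ 0)%C).
    { revert Hfz0; apply Cseries_ext; intros i; simpl; ring. }
    pose proof (Cseries_unique _ _ _ H1 H2) as E.
    unfold b, quot_coef; rewrite E; simpl; ring. }
  set (u := fun j => match j with O => f z0 | S j => (z * (b j * z ^ j))%C end).
  assert (Hu : Cseries u (f z0 + z * psum b z)%C).
  { apply Cseries_shift; simpl.
    replace (f z0 + z * psum b z - f z0)%C with (z * psum b z)%C by ring.
    now apply Cseries_scal. }
  apply (Cseries_scal (- z0)%C) in H.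
  pose proof (Cseries_plus _ _ _ _ Hu H) as Hs.
  apply (Cseries_unique (fun k => a k * z ^ k)%C); [exact Hfz |].
  replace (f z0 + (z - z0) * psum b z)%C
    with (f z0 + z * psum b z + - z0 * psum b z)%C by ring.
  revert Hs; apply Cseries_ext; intros [|j]; simpl.
  + rewrite E0; ring.
  + unfold b; rewrite (quot_coef_rec a z0 j Ha Hz0); ring.
-
  (* Summation by parts; the boundary term k b_k z0^k tends to 0. *)
  pose proof (psum_spec b z0 Hb Hz0) as H.
  pose proof (geom_bounded_terms_lim _ z0 (geom_bounded_nat b Hb) Hz0) as Hl.
  pose proof (Cseries_telescope _ Hl) as Ht.
  pose proof (Cseries_plus _ _ _ _ H Ht) as Hs.
  replace (psum b z0) with (psum b z0 + INR 0 * b 0%nat * z0 ^ 0)%C by (simpl; ring).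
  revert Hs; apply Cseries_ext; intros k; cbv beta.
  replace (a (S k)) with (b k - z0 * b (S k))%C
    by (unfold b; rewrite (quot_coef_rec a z0 k Ha Hz0); ring).
  rewrite S_INR, RtoC_plus, Cpow_S; ring.
Qed.

Lemma power_series_cont (a : nat -> C) (f : C -> C) (z0 : C) :
  power_series_on_disk a f -> disk 1 z0 -> cont f z0.
Proof.
unfold disk; intros Hf Hz0 e He.
destruct (power_series_factor a f z0 Hf Hz0) as (b & f1 & Hb & Hfac & _).
pose proof (Cmod_ge_0 z0) as H0.
destruct (power_series_bounded b f1 ((1 + Cmod z0) / 2) Hb) as [M HM]; [lra |].
set (M' := Rmax M 1).
assert (HM' : 0 < M') by (eapply Rlt_le_trans; [apply Rlt_0_1 | apply Rmax_r]).
exists (Rmin ((1 - Cmod z0) / 2) (e / M')); split.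
{ apply Rmin_glb_lt; [lra | now apply Rdiv_lt_0_compat]. }
intros t Ht.
assert (Ht1 : Cmod (t - z0) < (1 - Cmod z0) / 2) by (eapply Rlt_le_trans; [exact Ht | apply Rmin_l]).
assert (Ht2 : Cmod (t - z0) < e / M') by (eapply Rlt_le_trans; [exact Ht | apply Rmin_r]).
assert (Ht3 : Cmod t <= (1 + Cmod z0) / 2).
{ replace t with (z0 + (t - z0))%C by ring.
  eapply Rle_trans; [apply Cmod_triangle | lra]. }
rewrite (Hfac t) by (unfold disk; lra).
replace (f z0 + (t - z0) * f1 t - f z0)%C with ((t - z0) * f1 t)%C by ring.
rewrite Cmod_mult.
apply Rle_lt_trans with (Cmod (t - z0) * M').
- apply Rmult_le_compat_l; [apply Cmod_ge_0 |].
  eapply Rle_trans; [now apply HM | apply Rmax_l].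
- apply Rmult_lt_reg_r with (/ M'); [now apply Rinv_0_lt_compat |].
  rewrite Rmult_assoc, Rinv_r by lra. lra.
Qed.

Lemma power_series_jet (k : nat) (a : nat -> C) (f : C -> C) (z0 : C) :
  power_series_on_disk a f -> disk 1 z0 -> jet k f z0.
Proof.
revert a f; induction k as [|k IH]; intros a f Hf Hz0.
- now apply (power_series_cont a).
- destruct (power_series_factor a f z0 Hf Hz0) as (b & f1 & Hb & Hfac & _).
  exists f1; split; [| now apply (IH b)].
  generalize (near_disk 1 z0 Hz0); apply near_imp; intros t Ht; now apply Hfac.
Qed.

Lemma power_series_derive (a : nat -> C) (f : C -> C) (z0 : C) :
  power_series_on_disk a f -> disk 1 z0 ->
  is_derive (K := C_AbsRing) (V := C_NormedModule) f z0
    (psum (fun k => INR (S k) * a (S k))%C z0).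
Proof.
intros Hf Hz0.
pose proof (power_series_geom_bounded _ _ Hf) as Ha.
destruct (power_series_factor a f z0 Hf Hz0) as (b & f1 & Hb & Hfac & Hd).
replace (psum (fun k => INR (S k) * a (S k))%C z0) with (f1 z0).
- apply caratheodory; [| now apply (power_series_cont b)].
  generalize (near_disk 1 z0 Hz0); apply near_imp; intros t Ht; now apply Hfac.
- apply (Cseries_unique _ _ _ Hd). apply psum_spec; [| exact Hz0].
  exact (geom_bounded_shift _ 1 (geom_bounded_nat a Ha)).
Qed.

Lemma psum_0 (a : nat -> C) : geom_bounded a -> psum a 0 = a 0%nat.
Proof.
intros Ha. apply (Cseries_unique (fun k => a k * 0 ^ k)%C).
- apply psum_spec; [exact Ha |]. unfold disk; rewrite Cmod_0; lra.
- apply (proj1 (pseries_Cseries _ _ _)).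
  exact (is_pseries_0 (K := C_AbsRing) (V := C_NormedModule) a).
Qed.

Lemma Cseries_drop_zeros (m : nat) (u : nat -> C) (l : C) :
  (forall k, (k < m)%nat -> u k = 0) -> Cseries u l ->
  Cseries (fun k => u (m + k)%nat) l.
Proof.
intros Hu H; induction m as [|m IH]; [exact H |].
assert (IH' := IH (fun k Hk => Hu k (Nat.lt_lt_succ_r _ _ Hk))).
apply (proj1 (Cseries_shift _ _)) in IH'; cbv beta in IH'. rewrite Nat.add_0_r, Hu in IH' by lia.
replace l with (l - 0)%C by ring.
revert IH'; apply Cseries_ext; intros k. f_equal; lia.
Qed.

Lemma power_series_one_plus (n : nat) (c : nat -> C) (p : C -> C) :
  (1 <= n)%nat -> c 0%nat = 1 -> (forall k, (0 < k < n)%nat -> c k = 0) ->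
  power_series_on_disk c p ->
  forall z, disk 1 z -> (p z = 1 + z ^ n * psum (fun k => c (n + k)%nat) z)%C.
Proof.
intros Hn Hc0 Hc Hp z Hz.
pose proof (power_series_geom_bounded _ _ Hp) as Hb.
pose proof (proj1 (pseries_Cseries _ _ _) (Hp z Hz)) as H.
apply (proj1 (Cseries_shift _ _)), (Cseries_drop_zeros (n - 1)) in H.
- pose proof (psum_spec _ z (geom_bounded_shift c n Hb) Hz) as Hs.
  apply (Cseries_scal (z ^ n)%C) in Hs.
  assert (E : (p z - c 0%nat * z ^ 0 = z ^ n * psum (fun k => c (n + k)%nat) z)%C).
  { apply (Cseries_unique _ _ _ H). revert Hs; apply Cseries_ext; intros k.
    replace (S (n - 1 + k)) with (n + k)%nat by lia. rewrite Cpow_add_r; ring. }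
  rewrite <- E, Hc0; simpl; ring.
- intros k Hk; rewrite Hc by lia; ring.
Qed.

(** The coefficients of F(z^n), where F has the coefficients [e]. *)
Definition spread (n : nat) (e : nat -> C) (m : nat) : C :=
  if Nat.eqb (m mod n) 0 then e (m / n)%nat else RtoC 0.

Lemma Cseries_spread (n : nat) (e : nat -> C) (z l : C) :
  (1 <= n)%nat -> Cseries (fun k => e k * (z ^ n) ^ k)%C l ->
  Cseries (fun m => spread n e m * z ^ m)%C l.
Proof.
intros Hn H.
assert (Hs : forall m, csum (fun m => spread n e m * z ^ m)%C m =
                       csum (fun k => e k * (z ^ n) ^ k)%C (m / n)).
{ induction m as [|m IH].
  - rewrite Nat.Div0.div_0_l, !csum_0; unfold spread.
    rewrite Nat.Div0.mod_0_l, Nat.Div0.div_0_l; reflexivity.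
  - rewrite csum_S, IH; unfold spread.
    pose proof (Nat.div_mod_eq (S m) n) as Hdm.
    pose proof (Nat.mod_upper_bound (S m) n ltac:(lia)) as Hub.
    destruct (Nat.eqb_spec (S m mod n) 0) as [E|E].
    + rewrite E, Nat.add_0_r in Hdm.
      destruct (S m / n)%nat as [|q] eqn:Eq; [lia |].
      assert (Em : (m / n)%nat = q).
      { symmetry; apply Nat.div_unique with (n - 1)%nat; [lia |]. nia. }
      rewrite Em, csum_S, <- Cpow_mult_r, <- Hdm; reflexivity.
    + assert (Em : (m / n)%nat = (S m / n)%nat).
      { symmetry; apply Nat.div_unique with (S m mod n - 1)%nat; lia. }
      rewrite Em; ring. }
apply Cseries_eps; intros d Hd.
destruct (proj1 (Cseries_eps _ _) H d Hd) as [N HN].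
exists (n * N)%nat; intros m Hm; rewrite Hs; apply HN.
apply Nat.div_le_lower_bound; lia.
Qed.

Lemma Cseries_geom (q : C) : Cmod q < 1 -> Cseries (fun k => q ^ k)%C (/ (1 - q))%C.
Proof.
intros Hq.
destruct (Cseries_ex_geom (fun k => q ^ k)%C 1 (Cmod q)) as [l Hl].
{ split; [apply Cmod_ge_0 | exact Hq]. }
{ intros k; rewrite Cmod_pow; lra. }
pose proof (proj1 (Cseries_shift _ _) Hl) as H1.
pose proof (Cseries_unique _ _ _ H1 (Cseries_scal q _ _ Hl)) as E; simpl in E.
assert (Hn : (1 - q)%C <> 0).
{ intros E0. assert (Eq : q = RtoC 1) by (symmetry; now apply Ceq_minus).
  rewrite Eq, Cmod_1 in Hq; lra. }
replace (/ (1 - q))%C with l; [exact Hl |].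
apply (Cmult_cancel_l (1 - q)); [| exact Hn].
rewrite Cinv_r by exact Hn.
replace ((1 - q) * l)%C with (l - 1 + 1 - q * l)%C by ring. rewrite E; ring.
Qed.

(** * Complex derivatives *)

Definition Cderiv (f : C -> C) (z l : C) : Prop :=
  is_derive (K := C_AbsRing) (V := C_NormedModule) f z l.

(** The rules [is_derive_mult] and [is_derive_comp] require values in the
    absolute ring, whose normed module structure is not convertible to
    [C_NormedModule]. *)
Lemma Cderiv_AbsRing (f : C -> C) (z l : C) :
  Cderiv f z l <->
  is_derive (K := C_AbsRing) (V := AbsRing_NormedModule C_AbsRing) f z l.
Proof. split; intros [_ H]; (split; [apply is_linear_scal_l | exact H]). Qed.

Lemma Cderiv_mult (f g : C -> C) (z l m : C) :
  Cderiv f z l -> Cderiv g z m ->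
  Cderiv (fun t => f t * g t)%C z (l * g z + f z * m)%C.
Proof.
intros Hf%Cderiv_AbsRing Hg%Cderiv_AbsRing; apply Cderiv_AbsRing.
apply (is_derive_mult (K := C_AbsRing) f g z l m Hf Hg).
exact Cmult_comm.
Qed.

Lemma Cderiv_comp (f g : C -> C) (z l m : C) :
  Cderiv f (g z) l -> Cderiv g z m -> Cderiv (fun t => f (g t)) z (m * l)%C.
Proof. intros Hf Hg%Cderiv_AbsRing; exact (is_derive_comp (K := C_AbsRing) f g z l m Hf Hg). Qed.

Lemma Cderiv_id (z : C) : Cderiv (fun t => t) z 1.
Proof. apply Cderiv_AbsRing; exact (is_derive_id (K := C_AbsRing) z). Qed.

Lemma Cderiv_pow (n : nat) (z : C) : Cderiv (fun t => t ^ S n)%C z (INR (S n) * z ^ n)%C.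
Proof.
induction n as [|n IH].
- replace (INR 1 * z ^ 0)%C with (1 * 1 + z * 0)%C by (simpl; ring).
  apply (Cderiv_mult (fun t => t) (fun _ => RtoC 1)); [apply Cderiv_id |].
  exact (is_derive_const (K := C_AbsRing) (V := C_NormedModule) (RtoC 1) z).
- replace (INR (S (S n)) * z ^ S n)%C
    with (1 * z ^ S n + z * (INR (S n) * z ^ n))%C
    by (rewrite (S_INR (S n)), RtoC_plus; simpl Cpow; ring).
  apply (Cderiv_mult (fun t => t) (fun t => t ^ S n)%C); [apply Cderiv_id | exact IH].
Qed.

Lemma Cderiv_ext_disk (f g : C -> C) (z l : C) :
  (forall t, disk 1 t -> f t = g t) -> disk 1 z -> Cderiv f z l -> Cderiv g z l.
Proof.
intros H Hz. apply is_derive_ext_loc.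
destruct (near_disk 1 z Hz) as [d [Hd HP]].
exists (mkposreal d Hd); intros t Ht; apply H, HP, Ht.
Qed.

Lemma Cderiv_zero_near (f : C -> C) (z : C) :
  Cderiv f z 0 ->
  forall e, 0 < e -> near z (fun t => Cmod (f t - f z) <= e * Cmod (t - z)).
Proof.
intros [_ H] e He.
destruct (H z (fun P HP => HP) (mkposreal e He)) as [d Hd].
exists d; split; [apply cond_pos |]; intros t Ht.
specialize (Hd t Ht).
change (Cmod ((f t - f z) - (t - z) * 0)%C <= e * Cmod (t - z)%C) in Hd.
now replace (f t - f z - (t - z) * 0)%C with (f t - f z)%C in Hd by ring.
Qed.

(** The real and the imaginary part of t |-> f (t z) have derivative 0 on
    [0, 1]. *)
Lemma Cderiv_zero_const (f : C -> C) :
  (forall z, disk 1 z -> Cderiv f z 0) -> forall z, disk 1 z -> f z = f 0.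
Proof.
intros Hf z Hz.
assert (Hproj : forall pr : C -> R,
  (forall a b, Rabs (pr a - pr b) <= Cmod (a - b)) -> pr (f z) = pr (f 0)).
{ intros pr Hpr.
  assert (H : Rabs (pr (f (1 * z)%C) - pr (f (0 * z)%C)) <= 0 * Rabs (1 - 0)).
  { apply (bounded_variation (fun t => pr (f (t * z)%C)) (fun _ => 0) 0 0 1).
    intros t Ht; split; [| rewrite Rabs_R0; lra].
    assert (Htz : disk 1 (t * z)%C).
    { unfold disk in *; rewrite Cmod_mult, Cmod_R.
      rewrite !Rminus_0_r, Rabs_R1 in Ht. pose proof (Cmod_ge_0 z); nra. }
    apply is_derive_Reals; intros e He.
    assert (He2 : 0 < e / 2) by lra.
    destruct (Cderiv_zero_near f _ (Hf _ Htz) (e / 2) He2) as [d [Hd HP]].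
    exists (mkposreal d Hd); intros s Hs Hsd; simpl in Hsd.
    assert (Hdist : Cmod ((t + s)%R * z - t * z) <= Rabs s).
    { replace ((t + s)%R * z - t * z)%C with (s * z)%C by (rewrite RtoC_plus; ring).
      rewrite Cmod_mult, Cmod_R. unfold disk in Hz.
      pose proof (Rabs_pos s); pose proof (Cmod_ge_0 z); nra. }
    assert (Hlt : Cmod ((t + s)%R * z - t * z) < d) by lra.
    specialize (HP _ Hlt). specialize (Hpr (f ((t + s)%R * z)%C) (f (t * z)%C)).
    assert (Hs0 : 0 < Rabs s) by now apply Rabs_pos_lt.
    rewrite Rminus_0_r. unfold Rdiv; rewrite Rabs_mult, Rabs_inv.
    apply Rmult_lt_reg_r with (Rabs s); [exact Hs0 |].
    rewrite Rmult_assoc, Rinv_l by lra. nra. }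
  rewrite Cmult_1_l, Cmult_0_l, Rmult_0_l in H.
  apply Rminus_diag_uniq. destruct (Req_dec (pr (f z) - pr (f 0)) 0) as [E|E]; [exact E |].
  apply Rabs_pos_lt in E; lra. }
assert (Hmax : forall c : C, Rabs (fst c) <= Cmod c /\ Rabs (snd c) <= Cmod c).
{ intros c; split; eapply Rle_trans; try apply Rmax_Cmod; [apply Rmax_l | apply Rmax_r]. }
apply injective_projections; apply Hproj; intros a b; exact ltac:(apply (Hmax (a - b)%C)).
Qed.

(** * Janowski functions and the lemniscate *)

Lemma disk_denominator (B : R) (w : C) :
  -1 <= B <= 1 -> disk 1 w -> (1 + B * w)%C <> 0.
Proof.
unfold disk; intros HB Hw E.
assert (H : Cmod (B * w) = 1).
{ replace (B * w)%C with ((1 + B * w) + - (1))%C by ring.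
  rewrite E, Cplus_0_l; apply Cmod_m1. }
rewrite Cmod_mult, Cmod_R in H.
assert (Rabs B <= 1) by (apply Rabs_le; lra).
pose proof (Cmod_ge_0 w); nra.
Qed.

Lemma sqrt2_gt1 : 1 < sqrt 2.
Proof. rewrite <- sqrt_1; apply sqrt_lt_1; lra. Qed.

(** Solving for w gives w = (p - 1) / (A - B p), and
    A - B p = (A - B) / (1 + B w) has no zero; so w = z^n h with
    h = g / (A - B p), to which [schwarz_order] applies. *)
Lemma janowski_schwarz (n : nat) (A B : R) (p g w : C -> C) :
  -1 <= B -> B < A -> A <= 1 ->
  (forall z, disk 1 z -> disk 1 (w z)) ->
  (forall z, disk 1 z -> p z = (1 + A * w z) / (1 + B * w z))%C ->
  (forall z, disk 1 z -> p z = 1 + z ^ n * g z)%C ->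
  (forall z, disk 1 z -> jet 2 p z) -> (forall z, disk 1 z -> jet 2 g z) ->
  forall z, disk 1 z -> Cmod (w z) <= Cmod z ^ n.
Proof.
intros HB HBA HA Hw Hp Hg Jp Jg.
set (q := fun z => (A + - B * p z)%C).
assert (HAB : (RtoC A - RtoC B)%C <> 0).
{ rewrite <- RtoC_minus; intros E%RtoC_inj; lra. }
assert (Hq : forall z, disk 1 z -> (q z = (A - B) / (1 + B * w z))%C).
{ intros z Hz; unfold q; rewrite (Hp z Hz).
  field; apply disk_denominator; [lra | now apply Hw]. }
assert (Hq0 : forall z, disk 1 z -> q z <> 0).
{ intros z Hz E; rewrite (Hq z Hz) in E.
  assert (Hd : (1 + B * w z)%C <> 0) by (apply disk_denominator; [lra | now apply Hw]).
  apply HAB. replace (A - B)%C with ((A - B) / (1 + B * w z) * (1 + B * w z))%C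
    by now field.
  rewrite E; ring. }
assert (Hh : forall z, disk 1 z -> (z ^ n * (g z * / q z))%C = w z).
{ intros z Hz.
  assert (Hd : (1 + B * w z)%C <> 0) by (apply disk_denominator; [lra | now apply Hw]).
  replace (z ^ n * (g z * / q z))%C with ((1 + z ^ n * g z - 1) / q z)%C
    by (field; now apply Hq0).
  rewrite <- (Hg z Hz), (Hq z Hz), (Hp z Hz). field. now split. }
assert (Hb : forall z, disk 1 z -> Cmod (g z * / q z) <= 1).
{ apply schwarz_order with (n := n).
  - intros z Hz; apply jet_mult; [now apply Jg |].
    apply jet_inv; [| now apply Hq0].
    apply (jet_plus 2 (fun _ => RtoC A)); [apply jet_const |].
    apply jet_mult; [apply jet_const | now apply Jp].
  - intros z Hz; rewrite (Hh z Hz); left; now apply Hw. }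
intros z Hz; rewrite <- (Hh z Hz), Cmod_mult, Cmod_pow.
rewrite <- (Rmult_1_r (Cmod z ^ n)) at 2.
apply Rmult_le_compat_l; [apply pow_le, Cmod_ge_0 | now apply Hb].
Qed.

Lemma lemniscate_of_near_one (p : C) :
  Cmod (p - 1) < sqrt 2 - 1 -> Cmod (p ^ 2 - 1) < 1.
Proof.
intros H.
replace (p ^ 2 - 1)%C with ((p - 1) * (2 + (p - 1)))%C by (simpl; ring).
rewrite Cmod_mult.
assert (H2 : Cmod (2 + (p - 1)) < sqrt 2 + 1).
{ eapply Rle_lt_trans; [apply Cmod_triangle |].
  rewrite Cmod_R, Rabs_pos_eq by lra; lra. }
assert (Hs : (sqrt 2 - 1) * (sqrt 2 + 1) = 1).
{ ring_simplify. rewrite pow2_sqrt by lra; lra. }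
apply Rlt_le_trans with ((sqrt 2 - 1) * (sqrt 2 + 1)); [| lra].
apply Rmult_le_0_lt_compat; auto using Cmod_ge_0.
Qed.

(** As B <= 0, |1 + B w| >= 1 + B |w|, so that for a given |w| the distance
    |p - 1| is largest when w is positive; the bound on |w| says that it is then
    less than sqrt 2 - 1. *)
Lemma janowski_lemniscate (A B : R) (w : C) :
  -1 <= B -> B < A -> A <= 1 -> B <= 0 -> Cmod w < 1 ->
  (A - sqrt 2 * B) * Cmod w < sqrt 2 - 1 ->
  Cmod (((1 + A * w) / (1 + B * w)) ^ 2 - 1)%C < 1.
Proof.
intros HB HBA HA HB0 Hw H.
pose proof (disk_denominator B w ltac:(lra) Hw) as Hd.
apply lemniscate_of_near_one.
replace ((1 + A * w) / (1 + B * w) - 1)%C with ((A - B)%R * w / (1 + B * w))%C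
  by (rewrite RtoC_minus; field; exact Hd).
rewrite Cmod_div, Cmod_mult, Cmod_R, Rabs_pos_eq by (try assumption; lra).
assert (Hm : 1 + B * Cmod w <= Cmod (1 + B * w)).
{ assert (1 <= Cmod (1 + B * w) + Cmod (B * w)).
  { apply Rle_trans with (Cmod 1); [rewrite Cmod_1; lra | rewrite <- (Cmod_opp (B * w))].
    replace (RtoC 1) with ((1 + B * w) + - (B * w))%C at 1 by ring.
    apply Cmod_triangle. }
  rewrite Cmod_mult, Cmod_R, Rabs_left1 in H0 by exact HB0. lra. }
pose proof (Cmod_ge_0 w). assert (Hp : 0 < 1 + B * Cmod w) by nra.
pose proof sqrt2_gt1 as Hs.
apply Rmult_lt_reg_r with (Cmod (1 + B * w)); [lra |].
unfold Rdiv; rewrite Rmult_assoc, Rinv_l by lra.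
apply Rlt_le_trans with ((sqrt 2 - 1) * (1 + B * Cmod w)).
- lra.
- apply Rmult_le_compat_l; lra.
Qed.

Lemma STn_schwarz (n : nat) (A B : R) (f : C -> C) :
  (1 <= n)%nat -> -1 <= B -> B < A -> A <= 1 -> class_STn n A B f ->
  forall z, disk 1 z -> exists w, Cmod w < 1 /\ Cmod w <= Cmod z ^ n /\
    (log_deriv f z = (1 + A * w) / (1 + B * w))%C.
Proof.
intros Hn HB HBA HA [_ [_ [[c [Hc0 [Hc Hp]]] [_ [_ [w [_ [_ [Hw1 Hw2]]]]]]]]] z Hz.
exists (w z); repeat split; [now apply Hw1 | | now apply Hw2].
revert z Hz; apply (janowski_schwarz n A B (log_deriv f) (psum (fun k => c (n + k)%nat)));
  try assumption.
- now apply power_series_one_plus.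
- intros z Hz; now apply (power_series_jet 2 c).
- intros z Hz; apply (power_series_jet 2 (fun k => c (n + k)%nat)); [| exact Hz].
  apply power_series_psum, geom_bounded_shift.
  exact (power_series_geom_bounded _ _ Hp).
Qed.

(** The expansion p = 1 + z (phi' / phi), with f = z phi, replaces the power
    series of p that is part of [class_P]. *)
Lemma ST_schwarz (f : C -> C) :
  class_ST f ->
  forall z, disk 1 z -> exists w, Cmod w < 1 /\ Cmod w <= Cmod z /\
    (log_deriv f z = (1 + 1 * w) / (1 + (-1)%R * w))%C.
Proof.
intros [[_ [a [Ha0 [Ha1 [_ Hf]]]]] [_ [_ [w [_ [Hw0 [Hw1 Hw2]]]]]]].
assert (Hw2' : forall z, disk 1 z -> (log_deriv f z = (1 + 1 * w z) / (1 + (-1)%R * w z))%C).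
{ intros z Hz; rewrite (Hw2 z Hz). rewrite Cmult_1_l; f_equal.
  replace (RtoC (-1)) with (- (1))%C by (rewrite <- RtoC_opp; f_equal; ring). ring. }
pose proof (power_series_geom_bounded _ _ Hf) as Hb.
pose proof (power_series_psum _ (geom_bounded_shift a 1 Hb)) as Hphi.
set (phi := psum (fun k => a (1 + k)%nat)) in *.
pose proof (fun z => power_series_derive _ phi z Hphi) as Hder.
set (phi' := psum (fun k => INR (S k) * a (1 + S k)%nat)%C) in *.
assert (Hfphi : forall z, disk 1 z -> (f z = z * phi z)%C).
{ intros z Hz. pose proof (proj1 (pseries_Cseries _ _ _) (Hf z Hz)) as H.
  apply (proj1 (Cseries_shift _ _)) in H.
  pose proof (psum_spec _ z (geom_bounded_shift a 1 Hb) Hz) as Hs.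
  apply (Cseries_scal z) in Hs.
  assert (E : (f z - a 0%nat * z ^ 0 = z * phi z)%C).
  { apply (Cseries_unique _ _ _ H). revert Hs; apply Cseries_ext; intros k; simpl; ring. }
  rewrite <- E, Ha0; ring. }
assert (Hphi0 : phi 0 = 1).
{ rewrite <- Ha1. exact (psum_0 _ (geom_bounded_shift a 1 Hb)). }
assert (Hphin : forall z, disk 1 z -> phi z <> 0).
{ intros z Hz E.
  destruct (Ceq_dec z 0) as [->|Hz0]; [rewrite Hphi0 in E; now apply C1_nz |].
  specialize (Hw2' z Hz). unfold log_deriv in Hw2'.
  destruct (Ceq_dec z 0) as [|_]; [contradiction |].
  rewrite (Hfphi z Hz), E in Hw2'.
  assert (Hd := disk_denominator (-1) (w z) ltac:(lra) (Hw1 z Hz)).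
  apply (disk_denominator 1 (w z) ltac:(lra) (Hw1 z Hz)).
  replace (1 + 1 * w z)%C with ((1 + 1 * w z) / (1 + (-1)%R * w z) * (1 + (-1)%R * w z))%C
    by now field.
  rewrite <- Hw2'. unfold Cdiv.
  replace (z * 0)%C with (RtoC 0) by ring.
  replace (/ 0)%C with (RtoC 0); [ring |].
  apply injective_projections; simpl; unfold Rdiv; ring. }
assert (Hld : forall z, disk 1 z -> (log_deriv f z = 1 + z ^ 1 * (phi' z * / phi z))%C).
{ intros z Hz; unfold log_deriv.
  destruct (Ceq_dec z 0) as [->|Hz0]; [simpl; ring |].
  assert (Hd : Cderiv f z (1 * phi z + z * phi' z)%C).
  { apply (Cderiv_ext_disk (fun t => t * phi t)%C); [| exact Hz |].
    - intros t Ht; symmetry; now apply Hfphi.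
    - apply (Cderiv_mult (fun t => t)); [apply Cderiv_id | now apply Hder]. }
  rewrite (is_C_derive_unique _ _ _ Hd), (Hfphi z Hz).
  simpl Cpow; field; split; [now apply Hphin | exact Hz0]. }
assert (Hjg : forall z, disk 1 z -> jet 2 (fun t => phi' t * / phi t)%C z).
{ intros z Hz; apply jet_mult.
  - apply (power_series_jet 2 (fun k => INR (S k) * a (1 + S k)%nat)%C); [| exact Hz].
    apply power_series_psum.
    exact (geom_bounded_shift _ 1 (geom_bounded_nat _ (geom_bounded_shift a 1 Hb))).
  - apply jet_inv; [| now apply Hphin].
    now apply (power_series_jet 2 (fun k => a (1 + k)%nat)). }
intros z Hz; exists (w z); repeat split; [now apply Hw1 | | now apply Hw2'].
rewrite <- (pow_1 (Cmod z)).
revert z Hz; apply (janowski_schwarz 1 1 (-1) (log_deriv f) (fun t => phi' t * / phi t)%C);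
  try assumption; try lra.
intros z Hz.
apply jet_ext with (f := fun t => (1 + t ^ 1 * (phi' t * / phi t))%C).
- generalize (near_disk 1 z Hz); apply near_imp; intros t Ht; now rewrite Hld.
- apply (jet_plus 2 (fun _ => RtoC 1)); [apply jet_const |].
  apply jet_mult; [apply jet_pow | now apply Hjg].
Qed.

(** * The extremal function *)

Lemma disk_pow (n : nat) (z : C) : (1 <= n)%nat -> disk 1 z -> disk 1 (z ^ n)%C.
Proof.
unfold disk; intros Hn Hz; rewrite Cmod_pow.
destruct n as [|n]; [lia |]; simpl.
assert (Cmod z ^ n <= 1).
{ rewrite <- (pow1 n); apply pow_incr; pose proof (Cmod_ge_0 z); lra. }
pose proof (Cmod_ge_0 z); nra.
Qed.

(** The Taylor coefficients of (1 + B u)^(alpha / B), or of exp (alpha u) when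
    B = 0. *)
Fixpoint binom_coef (alpha B : R) (k : nat) : R :=
  match k with
  | O => 1
  | S k => (alpha - B * INR k) / INR (S k) * binom_coef alpha B k
  end.

(** The ratio of consecutive coefficients is at most (k + 2) / (k + 1). *)
Lemma binom_coef_bound (alpha B : R) (k : nat) :
  Rabs alpha <= 2 -> Rabs B <= 1 -> Rabs (binom_coef alpha B k) <= INR (S k).
Proof.
intros Ha HB; induction k as [|k IH]; [simpl; rewrite Rabs_R1; lra |].
cbn [binom_coef].
assert (H0 : 0 < INR (S k)) by (apply lt_0_INR; lia).
rewrite Rabs_mult. unfold Rdiv; rewrite Rabs_mult, Rabs_inv, (Rabs_pos_eq (INR (S k))) by lra.
assert (Hn : Rabs (alpha - B * INR k) <= INR (S (S k))).
{ rewrite !S_INR. eapply Rle_trans; [apply Rabs_triang |].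
  rewrite Rabs_Ropp, Rabs_mult, (Rabs_pos_eq (INR k)) by apply pos_INR.
  pose proof (pos_INR k); nra. }
apply Rle_trans with (INR (S (S k)) * / INR (S k) * INR (S k)).
- apply Rmult_le_compat; try assumption; try apply Rabs_pos.
  + apply Rmult_le_pos; [apply Rabs_pos | left; now apply Rinv_0_lt_compat].
  + apply Rmult_le_compat_r; [left; now apply Rinv_0_lt_compat | exact Hn].
- right; field; lra.
Qed.

Lemma binom_coef_geom_bounded (alpha B : R) :
  Rabs alpha <= 2 -> Rabs B <= 1 -> geom_bounded (fun k => RtoC (binom_coef alpha B k)).
Proof.
intros Ha HB r Hr; exists (/ (1 - r) + 1); intros k.
rewrite Cmod_R.
assert (Hk : 0 <= r ^ k) by (apply pow_le; lra).
apply Rle_trans with (INR (S k) * r ^ k).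
- apply Rmult_le_compat_r; [exact Hk | now apply binom_coef_bound].
- rewrite S_INR, Rmult_plus_distr_r, Rmult_1_l. apply Rplus_le_compat.
  + apply nat_geom_bounded; lra.
  + rewrite <- (pow1 k); apply pow_incr; lra.
Qed.

Definition binom_fun (alpha B : R) : C -> C :=
  psum (fun k => RtoC (binom_coef alpha B k)).

Lemma binom_ode (alpha B : R) (u : C) :
  Rabs alpha <= 2 -> Rabs B <= 1 -> disk 1 u ->
  exists d, Cderiv (binom_fun alpha B) u d /\
    ((1 + B * u) * d = alpha * binom_fun alpha B u)%C.
Proof.
intros Ha HB Hu.
pose proof (binom_coef_geom_bounded alpha B Ha HB) as Hb.
set (e := fun k => RtoC (binom_coef alpha B k)) in *.
exists (psum (fun k => INR (S k) * e (S k))%C u); split.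
{ apply power_series_derive; [now apply power_series_psum | exact Hu]. }
set (d := psum (fun k => INR (S k) * e (S k))%C u).
assert (Hd : Cseries (fun k => INR (S k) * e (S k) * u ^ k)%C d)
  by exact (psum_spec _ u (geom_bounded_shift _ 1 (geom_bounded_nat e Hb)) Hu).
assert (H2 : Cseries (fun k => B * (INR k * e k * u ^ k))%C (B * (u * d))%C).
{ apply Cseries_scal. apply (proj2 (Cseries_shift _ _)).
  replace (u * d - INR 0 * e 0%nat * u ^ 0)%C with (u * d)%C by (change (INR 0) with 0; ring).
  generalize (Cseries_scal u _ _ Hd); apply Cseries_ext; intros k.
  rewrite Cpow_S; ring. }
pose proof (psum_spec _ u Hb Hu) as H3. apply (Cseries_scal alpha) in H3.
replace ((1 + B * u) * d)%C with (d + B * (u * d))%C by ring.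
apply (Cseries_unique _ _ _ (Cseries_plus _ _ _ _ Hd H2)).
revert H3; apply Cseries_ext; intros k.
assert (E : (INR (S k) * e (S k) = (alpha - B * INR k) * e k)%C).
{ unfold e; rewrite <- !RtoC_mult, <- RtoC_minus, <- RtoC_mult; f_equal.
  cbn [binom_coef]; field. apply not_0_INR; lia. }
rewrite E; ring.
Qed.

(** The product of the functions of exponents alpha and - alpha is constant, by
    the differential equation. *)
Lemma binom_fun_neq0 (alpha B : R) (u : C) :
  Rabs alpha <= 2 -> Rabs B <= 1 -> disk 1 u -> binom_fun alpha B u <> 0.
Proof.
intros Ha HB Hu E.
assert (Ha' : Rabs (- alpha) <= 2) by now rewrite Rabs_Ropp.
set (P := fun u => (binom_fun alpha B u * binom_fun (- alpha) B u)%C).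
assert (HP : P u = P 0).
{ apply Cderiv_zero_const; [| exact Hu]; intros z Hz.
  destruct (binom_ode alpha B z Ha HB Hz) as [d1 [D1 E1]].
  destruct (binom_ode (- alpha) B z Ha' HB Hz) as [d2 [D2 E2]].
  pose proof (Cderiv_mult _ _ _ _ _ D1 D2) as D.
  assert (Hn : (1 + B * z)%C <> 0).
  { apply disk_denominator; [| exact Hz]. now apply Rabs_le_between. }
  replace (d1 * binom_fun (- alpha) B z + binom_fun alpha B z * d2)%C
    with (RtoC 0) in D; [exact D |].
  apply (Cmult_cancel_l (1 + B * z)); [| exact Hn].
  replace ((1 + B * z) * (d1 * binom_fun (- alpha) B z + binom_fun alpha B z * d2))%C
    with ((1 + B * z) * d1 * binom_fun (- alpha) B z
          + binom_fun alpha B z * ((1 + B * z) * d2))%C by ring.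
  rewrite E1, E2, RtoC_opp; ring. }
unfold P in HP; rewrite E in HP.
unfold binom_fun in HP; rewrite !psum_0 in HP by now apply binom_coef_geom_bounded.
simpl in HP. apply C1_nz. rewrite Cmult_0_l, Cmult_1_l in HP; auto.
Qed.

Definition janowski_coef (A B : R) (k : nat) : C :=
  match k with O => RtoC 1 | S k => ((A - B) * (- B) ^ k)%C end.

Lemma Cseries_janowski (A B : R) (u : C) :
  Rabs B <= 1 -> disk 1 u ->
  Cseries (fun k => janowski_coef A B k * u ^ k)%C ((1 + A * u) / (1 + B * u))%C.
Proof.
intros HB Hu.
assert (Hn : (1 + B * u)%C <> 0).
{ apply disk_denominator; [| exact Hu]. now apply Rabs_le_between. }
assert (Hq : Cmod (- B * u) < 1).
{ unfold disk in Hu; rewrite Cmod_mult, Cmod_opp, Cmod_R.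
  pose proof (Cmod_ge_0 u); nra. }
apply (proj2 (Cseries_shift _ _)); simpl janowski_coef.
pose proof (Cseries_scal ((A - B) * u)%C _ _ (Cseries_geom _ Hq)) as H.
replace ((1 + A * u) / (1 + B * u) - 1 * u ^ 0)%C
  with ((A - B) * u * / (1 - - B * u))%C.
- revert H; apply Cseries_ext; intros k. rewrite Cpow_mult_l, Cpow_S; ring.
- replace (1 - - B * u)%C with (1 + B * u)%C by ring. simpl; field; exact Hn.
Qed.

Definition extremal (n : nat) (A B : R) (z : C) : C :=
  (z * binom_fun ((A - B) / INR n) B (z ^ n))%C.

Lemma INR_ge1 (n : nat) : (1 <= n)%nat -> 1 <= INR n.
Proof. exact (le_INR 1 n). Qed.

Lemma exponent_bound (n : nat) (A B : R) :
  (1 <= n)%nat -> -1 <= B -> B < A -> A <= 1 -> Rabs ((A - B) / INR n) <= 2.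
Proof.
intros Hn%INR_ge1 HB HBA HA; rewrite Rabs_pos_eq.
- apply Rmult_le_reg_r with (INR n); [lra |].
  unfold Rdiv; rewrite Rmult_assoc, Rinv_l by lra. nra.
- apply Rdiv_le_0_compat; lra.
Qed.

Lemma extremal_log_deriv (n : nat) (A B : R) (z : C) :
  (1 <= n)%nat -> -1 <= B -> B < A -> A <= 1 ->
  disk 1 z ->
  ex_derive (K := C_AbsRing) (V := C_NormedModule) (extremal n A B) z /\
  (log_deriv (extremal n A B) z = (1 + A * z ^ n) / (1 + B * z ^ n))%C.
Proof.
intros Hn HB HBA HA Hz.
pose proof (disk_pow n z Hn Hz) as Hzn.
pose proof (exponent_bound n A B Hn HB HBA HA) as Ha.
assert (HBb : Rabs B <= 1) by (apply Rabs_le; lra).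
set (alpha := (A - B) / INR n) in *.
destruct (binom_ode alpha B (z ^ n)%C Ha HBb Hzn) as [d [Dd Ed]].
pose proof (binom_fun_neq0 alpha B _ Ha HBb Hzn) as H0.
assert (Hd : (1 + B * z ^ n)%C <> 0) by (apply disk_denominator; [lra | exact Hzn]).
pose proof (INR_ge1 n Hn) as Hn1.
assert (Hpow : exists m, n = S m) by (exists (n - 1)%nat; lia).
destruct Hpow as [m Em].
assert (Dp : Cderiv (fun t => t ^ n)%C z (INR n * z ^ m)%C)
  by (rewrite Em; apply Cderiv_pow).
pose proof (Cderiv_mult _ _ _ _ _ (Cderiv_id z)
  (Cderiv_comp (binom_fun alpha B) (fun t => t ^ n)%C _ _ _ Dd Dp)) as D.
change (Cderiv (extremal n A B) z
  (1 * binom_fun alpha B (z ^ n) + z * (INR n * z ^ m * d))%C) in D.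
split; [eexists; exact D |].
unfold log_deriv; destruct (Ceq_dec z 0) as [E|Hz0].
- rewrite E, Em, Cpow_S, !Cmult_0_l, !Cmult_0_r, !Cplus_0_r. field.
- rewrite (is_C_derive_unique _ _ _ D); unfold extremal; fold alpha.
  set (E0 := binom_fun alpha B (z ^ n)%C) in *.
  assert (Ed' : d = (alpha * E0 / (1 + B * z ^ n))%C).
  { rewrite <- Ed; field; exact Hd. }
  assert (Ezn : (z ^ n = z * z ^ m)%C) by (rewrite Em; apply Cpow_S).
  assert (Hna : (INR n * alpha = A - B)%C).
  { rewrite <- RtoC_mult, <- RtoC_minus; f_equal; unfold alpha; field; lra. }
  rewrite Ed'.
  replace (z * (1 * E0 + z * (INR n * z ^ m * (alpha * E0 / (1 + B * z ^ n)))) / (z * E0))%C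
    with (1 + INR n * alpha * (z * z ^ m) / (1 + B * z ^ n))%C
    by (field; repeat split; assumption).
  rewrite <- Ezn, Hna. field; exact Hd.
Qed.

Lemma extremal_class_A (n : nat) (A B : R) :
  (1 <= n)%nat -> -1 <= B -> B < A -> A <= 1 ->
  class_A n (extremal n A B).
Proof.
intros Hn HB HBA HA.
split; [intros z Hz; now apply extremal_log_deriv |].
set (e := fun k => RtoC (binom_coef ((A - B) / INR n) B k)).
assert (Hb : geom_bounded e)
  by (apply binom_coef_geom_bounded; [now apply exponent_bound | apply Rabs_le; lra]).
exists (fun m => match m with O => RtoC 0 | S j => spread n e j end).
repeat split.
- unfold spread; rewrite Nat.Div0.mod_0_l, Nat.Div0.div_0_l; reflexivity.
- intros k Hk; destruct k as [|j]; [lia |].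
  unfold spread; rewrite Nat.mod_small by lia.
  destruct (Nat.eqb_spec j 0); [lia | reflexivity].
- intros z Hz; apply (proj2 (pseries_Cseries _ _ _)).
  apply (proj2 (Cseries_shift _ _)).
  replace (extremal n A B z - 0 * z ^ 0)%C with (extremal n A B z)%C by ring.
  pose proof (psum_spec e _ Hb (disk_pow n z Hn Hz)) as H.
  generalize (Cseries_scal z _ _ (Cseries_spread n e z _ Hn H)).
  apply Cseries_ext; intros k; rewrite Cpow_S; ring.
Qed.

Lemma jet_janowski (A B : R) (k m : nat) (z : C) :
  -1 <= B <= 1 ->
  disk 1 (z ^ m)%C -> jet k (fun t => (1 + A * t ^ m) / (1 + B * t ^ m))%C z.
Proof.
intros HB Hz.
assert (Haff : forall a : C, jet k (fun t => 1 + a * t ^ m)%C z).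
{ intros a; apply (jet_plus k (fun _ => RtoC 1)); [apply jet_const |].
  apply jet_mult; [apply jet_const | apply jet_pow]. }
apply jet_mult; [apply Haff |]. apply jet_inv; [apply Haff |].
apply disk_denominator; [exact HB | exact Hz].
Qed.

Lemma extremal_STn (n : nat) (A B : R) :
  (1 <= n)%nat -> -1 <= B -> B < A -> A <= 1 ->
  class_STn n A B (extremal n A B).
Proof.
intros Hn HB HBA HA.
split; [now apply extremal_class_A |].
assert (Han : analytic_on_disk (log_deriv (extremal n A B))).
{ intros z Hz; apply jet_ex_derive.
  apply jet_ext with (f := fun t => ((1 + A * t ^ n) / (1 + B * t ^ n))%C).
  - generalize (near_disk 1 z Hz); apply near_imp; intros t Ht.
    symmetry; now apply extremal_log_deriv.
  - apply jet_janowski; [lra | now apply disk_pow]. }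
split; [exact Han |]; split.
- exists (spread n (janowski_coef A B)); repeat split.
  + unfold spread; rewrite Nat.Div0.mod_0_l, Nat.Div0.div_0_l; reflexivity.
  + intros k Hk; unfold spread; rewrite Nat.mod_small by lia.
    destruct (Nat.eqb_spec k 0); [lia | reflexivity].
  + intros z Hz; apply (proj2 (pseries_Cseries _ _ _)).
    rewrite (proj2 (extremal_log_deriv n A B z Hn HB HBA HA Hz)).
    apply Cseries_spread; [exact Hn |].
    apply Cseries_janowski; [apply Rabs_le; lra | now apply disk_pow].
- split; [exact Han |]; split.
  + intros z Hz; apply jet_ex_derive.
    apply jet_ext with (f := fun t => ((1 + A * t ^ 1) / (1 + B * t ^ 1))%C).
    * apply near_all; intros t; now rewrite Cpow_1_r.
    * apply jet_janowski; [lra | now rewrite Cpow_1_r].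
  + exists (fun z => z ^ n)%C; repeat split.
    * intros z Hz; apply jet_ex_derive, jet_pow.
    * destruct n as [|m]; [lia |]; simpl; ring.
    * intros z Hz; now apply disk_pow.
    * intros z Hz; now apply extremal_log_deriv.
Qed.

(** * The radius *)

Lemma radius_denominator_pos (A B : R) : B < A -> B <= 0 -> 0 < A - sqrt 2 * B.
Proof. pose proof sqrt2_gt1; nra. Qed.

Lemma radius_formula (A B : R) :
  B < A -> B <= 0 ->
  2 * (sqrt 2 - 1) /
    ((A - B) + sqrt ((A - B) ^ 2 + 4 * (sqrt 2 * B - A) * B * (sqrt 2 - 1))) =
  (sqrt 2 - 1) / (A - sqrt 2 * B).
Proof.
intros HBA HB0; pose proof sqrt2_gt1 as Hs.
pose proof (radius_denominator_pos A B HBA HB0) as Hp.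
replace ((A - B) ^ 2 + 4 * (sqrt 2 * B - A) * B * (sqrt 2 - 1))
  with ((A - B - 2 * (sqrt 2 - 1) * B) ^ 2) by ring.
rewrite sqrt_pow2 by nra. field. split; lra.
Qed.

(** The two classes of the theorem enter only through the bound
    |w(z)| <= |z|^n and the membership of the extremal function. *)
Lemma SL_radius_of_schwarz (M : (C -> C) -> Prop) (n : nat) (A B : R) :
  (1 <= n)%nat -> -1 <= B -> B < A -> A <= 1 -> B <= 0 ->
  (forall f, M f -> forall z, disk 1 z -> exists w, Cmod w < 1 /\
     Cmod w <= Cmod z ^ n /\ (log_deriv f z = (1 + A * w) / (1 + B * w))%C) ->
  M (extremal n A B) ->
  is_SL_radius M
    (Rmin 1 (Rpower ((sqrt 2 - 1) / (A - sqrt 2 * B)) (1 / INR n))).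
Proof.
intros Hn HB HBA HA HB0 Hup Hext.
pose proof sqrt2_gt1 as Hs.
pose proof (radius_denominator_pos A B HBA HB0) as Hp.
pose proof (INR_ge1 n Hn) as Hn1.
set (x := (sqrt 2 - 1) / (A - sqrt 2 * B)).
assert (Hx : 0 < x) by (apply Rdiv_lt_0_compat; lra).
assert (Ex : (A - sqrt 2 * B) * x = sqrt 2 - 1) by (unfold x; field; lra).
set (rho := Rpower x (1 / INR n)).
assert (Hrho : 0 < rho) by apply exp_pos.
assert (Hrhon : rho ^ n = x).
{ rewrite <- Rpower_pow by exact Hrho. unfold rho; rewrite Rpower_mult.
  replace (1 / INR n * INR n) with 1 by (field; lra). now apply Rpower_1. }
split; [split |].
- split; [now apply Rmin_glb_lt; [lra |] | apply Rmin_l].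
- intros f Hf r Hr z Hz.
  unfold disk in Hz.
  assert (H1 : Cmod z < 1) by (pose proof (Rmin_l 1 rho); lra).
  assert (H2 : Cmod z < rho) by (pose proof (Rmin_r 1 rho); lra).
  destruct (Hup f Hf z H1) as (w & Hw1 & Hwn & ->).
  apply janowski_lemniscate; try assumption.
  rewrite <- Ex. apply Rmult_lt_compat_l; [exact Hp |].
  eapply Rle_lt_trans; [exact Hwn |]. rewrite <- Hrhon.
  pose proof (Cmod_ge_0 z).
  destruct n as [|m]; [lia |]. simpl.
  assert (Cmod z ^ m <= rho ^ m) by (apply pow_incr; lra).
  assert (0 < rho ^ m) by now apply pow_lt.
  apply Rle_lt_trans with (Cmod z * rho ^ m).
  + now apply Rmult_le_compat_l.
  + now apply Rmult_lt_compat_r.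
- intros rho' [[Hr0 Hr1] Hr']; apply Rnot_lt_le; intros Hlt.
  assert (Hrho1 : rho < rho').
  { revert Hlt; unfold Rmin; destruct (Rle_dec 1 rho); lra. }
  assert (Hz : disk ((rho + rho') / 2) rho).
  { unfold disk; rewrite Cmod_R, Rabs_pos_eq; lra. }
  assert (Hz1 : disk 1 rho) by (unfold disk; rewrite Cmod_R, Rabs_pos_eq; lra).
  assert (Hl := Hr' _ Hext ((rho + rho') / 2) ltac:(lra) rho Hz).
  rewrite (proj2 (extremal_log_deriv n A B rho Hn HB HBA HA Hz1)) in Hl.
  rewrite <- RtoC_pow, Hrhon in Hl.
  assert (Hx1 : x < 1).
  { rewrite <- Hrhon.
    destruct n as [|m]; [lia |]; simpl.
    assert (rho ^ m <= 1) by (rewrite <- (pow1 m); apply pow_incr; lra).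
    assert (0 < rho ^ m) by now apply pow_lt. nra. }
  assert (Hd : 0 < 1 + B * x) by nra.
  replace ((1 + A * x) / (1 + B * x))%C with (RtoC (sqrt 2)) in Hl.
  + rewrite <- RtoC_pow, <- RtoC_minus, Cmod_R in Hl.
    rewrite pow2_sqrt in Hl by lra. rewrite Rabs_pos_eq in Hl; lra.
  + rewrite <- !RtoC_mult, <- !RtoC_plus, <- RtoC_div by lra. f_equal.
    apply Rmult_eq_reg_r with (1 + B * x); [| lra].
    unfold Rdiv; rewrite Rmult_assoc, Rinv_l; lra.
Qed.

Lemma STn_subset_SLn (n : nat) (A B : R) (f : C -> C) :
  (1 <= n)%nat -> -1 <= B -> B < A -> A <= 1 -> B <= 0 ->
  1 + A < sqrt 2 * (1 + B) -> class_STn n A B f -> class_SL n f.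
Proof.
intros Hn HB HBA HA HB0 Hc Hf; split; [apply Hf |]; intros z Hz.
destruct (STn_schwarz n A B f Hn HB HBA HA Hf z Hz) as (w & Hw & _ & ->).
apply janowski_lemniscate; try assumption.
pose proof (radius_denominator_pos A B HBA HB0); pose proof (Cmod_ge_0 w). nra.
Qed.

Lemma STn_ST (f : C -> C) : class_STn 1 1 (-1) f -> class_ST f.
Proof.
intros [HA [_ [_ [H1 [H2 [w [Hw1 [Hw2 [Hw3 Hw4]]]]]]]]].
assert (E : forall z : C, ((1 + 1 * z) / (1 + (-1)%R * z) = (1 + z) / (1 - z))%C).
{ intros z. rewrite Cmult_1_l; f_equal.
  replace (RtoC (-1)) with (- (1))%C by (rewrite <- RtoC_opp; f_equal; ring). ring. }
split; [exact HA |]. split; [exact H1 |]; split.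
- intros z Hz; destruct (H2 z Hz) as [l Hl]; exists l.
  revert Hl; apply is_derive_ext; exact E.
- exists w; repeat split; try assumption.
  intros z Hz; rewrite (Hw4 z Hz); apply E.
Qed.

Theorem theorem2p5 :
  (forall (n : nat) (A B : R),
     (1 <= n)%nat -> -1 <= B -> B < A -> A <= 1 -> B <= 0 ->
     is_SL_radius (class_STn n A B)
       (Rmin 1
          (Rpower
             (2 * (sqrt 2 - 1) /
              ((A - B) +
               sqrt ((A - B) ^ 2 + 4 * (sqrt 2 * B - A) * B * (sqrt 2 - 1))))
             (1 / INR n)))
     /\
     (1 + A < sqrt 2 * (1 + B) ->
      forall f : C -> C, class_STn n A B f -> class_SL n f))
  /\
  is_SL_radius class_ST (3 - 2 * sqrt 2).
Proof.
split.
- intros n A B Hn HB HBA HA HB0; split.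
  + rewrite radius_formula by assumption.
    apply SL_radius_of_schwarz; try assumption.
    * intros f Hf z Hz; now apply STn_schwarz with (n := n) (f := f).
    * now apply extremal_STn.
  + intros Hc f; now apply STn_subset_SLn.
- assert (Hs : sqrt 2 * sqrt 2 = 2) by (apply sqrt_sqrt; lra).
  pose proof sqrt2_gt1 as Hs1.
  replace (3 - 2 * sqrt 2)
    with (Rmin 1 (Rpower ((sqrt 2 - 1) / (1 - sqrt 2 * (-1))) (1 / INR 1))).
  + apply SL_radius_of_schwarz; try lra; try lia.
    * intros f Hf z Hz; rewrite pow_1; now apply ST_schwarz.
    * apply STn_ST, extremal_STn; lra || lia.
  + replace (1 / INR 1) with 1 by (simpl; field).
    replace ((sqrt 2 - 1) / (1 - sqrt 2 * -1)) with (3 - 2 * sqrt 2).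
    * rewrite Rpower_1 by nra. apply Rmin_right; lra.
    * apply Rmult_eq_reg_r with (1 - sqrt 2 * -1); [| lra].
      unfold Rdiv; rewrite Rmult_assoc, Rinv_l by lra. nra.
Qed.
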